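(* Let $X$ be a connected topological manifold of dimension greater than one, let $\Gamma$ be a simple graph without loops on the vertex set $[n]=\{1,\dots,n\}$, and let ${\bf x}=(x_1,\dots,x_n)\in F(X,n)\subset F(X,\Gamma)$ be a base point. Let $i:F(X,n)\hookrightarrow F(X,\Gamma)$ be the inclusion. Then there is an epimorphism between two short exact sequences, i.e. a commutative diagram of groups $$\begin{array}{ccccccccc} 1&\to&\pi_1(F(X,n),{\bf x})&\to&\pi_1^E(F(X,n),{\bf x},\mathrm{Aut}(\Gamma)({\bf x}))&\to&\mathrm{Aut}(\Gamma)&\to&1\\ &&\downarrow{\scriptstyle i_*}&&\downarrow{\scriptstyle i_*}&&\downarrow{\scriptstyle =}&&\\ 1&\to&\pi_1(F(X,\Gamma),{\bf x})&\to&\pi_1^E(F(X,\Gamma),{\bf x},\mathrm{Aut}(\Gamma)({\bf x}))&\to&\mathrm{Aut}(\Gamma)&\to&1 \end{array}$$ with exact rows and surjective vertical maps; or, in terms of braid groups, a commutative diagram $$\begin{array}{ccccccccc} 1&\to&P(X,n)&\to&B(X,n)|_{\mathrm{Aut}(\Gamma)}&\to&\mathrm{Aut}(\Gamma)&\to&1\\ &&\downarrow&&\downarrow&&\downarrow{\scriptstyle =}&&\\ 1&\to&P(X,\Gamma)&\to&B(X,\Gamma)&\to&\mathrm{Aut}(\Gamma)&\to&1 \end{array}$$ with exact rows and surjective vertical maps.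
   Context: Let $E(\Gamma)$ be the edge set of $\Gamma$ and $\overline{jk}$ the edge joining $j,k$. $F(X,\Gamma)=\{(x_1,\dots,x_n)\in X^{\times n}\mid x_j\neq x_k \text{ for } \overline{jk}\in E(\Gamma)\}$ with the subspace topology; $F(X,n)$ is the classical ordered configuration space of $n$ pairwise distinct points (the case of the complete graph). $\mathrm{Aut}(\Gamma)=\{\sigma\in\Sigma_n\mid \overline{\sigma(j)\sigma(k)}\in E(\Gamma)\iff\overline{jk}\in E(\Gamma)\}$ acts on $F(X,\Gamma)$ and on $F(X,n)$ by $(\sigma,(x_1,\dots,x_n))\mapsto(x_{\sigma(1)},\dots,x_{\sigma(n)})$; products of permutations are read left to right: $(\sigma\tau)(i)=\tau(\sigma(i))$. Write ${\bf x}_\sigma=(x_{\sigma(1)},\dots,x_{\sigma(n)})$, and for a path $\alpha=(\alpha_1,\dots,\alpha_n)$ write $\alpha_\sigma=(\alpha_{\sigma(1)},\dots,\alpha_{\sigma(n)})$. For $Y=F(X,n)$ or $Y=F(X,\Gamma)$, the extended fundamental group $\pi_1^E(Y,{\bf x},\mathrm{Aut}(\Gamma)({\bf x}))$ is the set of homotopy classes rel $\partial I$ of paths $\alpha:I=[0,1]\to Y$ with $\alpha(0)={\bf x}$ and $\alpha(1)$ in the orbit $\mathrm{Aut}(\Gamma)({\bf x})$, with operation $[\alpha]\bullet[\beta]=[\alpha\circ\beta_\sigma]$, where $\alpha(1)={\bf x}_\sigma$ and $\circ$ is concatenation of paths (first $\alpha$, then $\beta_\sigma$). The maps of the sequences are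 the inclusion of $\pi_1(Y,{\bf x})$ and $[\alpha]\mapsto\sigma$ where $\alpha(1)={\bf x}_\sigma$. The maps $i_*$ are $[\alpha]\mapsto[i\circ\alpha]$ (composition with $i$). Braid groups: for a path $\alpha$ in $F(X,\Gamma)$ with $\alpha(0)={\bf x}$, $\alpha(1)\in\mathrm{Aut}(\Gamma)({\bf x})$, $c(\alpha)=\{c(\alpha_1),\dots,c(\alpha_n)\}$ with $c(\alpha_i)=\{(\alpha_i(s),s)\mid s\in I\}\subset X\times I$. Put $c(\alpha)\sim c(\beta)$ if there are continuous maps $\widehat{h_i}(s,t)=(h_i(s,t),s)$, $i=1,\dots,n$, from $I\times I$ to $X\times I$ with $h_i(s,0)=\alpha_i(s)$, $h_i(s,1)=\beta_i(s)$, $h_i(0,t)=\alpha_i(0)=\beta_i(0)$, $h_i(1,t)=\alpha_i(1)=\beta_i(1)$, and $h_j(s,t)\ne h_k(s,t)$ for all $(s,t)$ whenever $\overline{jk}\in E(\Gamma)$. $B(X,\Gamma)$ is the group of classes $[c(\alpha)]$ with operation $[c(\alpha)]\star[c(\beta)]=[c(\alpha\circ\beta_\sigma)]$, $\alpha(1)={\bf x}_\sigma$, and $P(X,\Gamma)$ is the subgroup of classes with $\alpha(1)={\bf x}$. $P(X,n)$ is the classical pure braid group $\pi_1(F(X,n),{\bf x})$, $B(X,n)$ is the classical braid group $\pi_1(F(X,n)/\Sigma_n)\cong\pi_1^E(F(X,n),{\bf x},\Sigma_n({\bf x}))$, and $B(X,n)|_{\mathrm{Aut}(\Gamma)}$ is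 its subgroup $\pi_1^E(F(X,n),{\bf x},\mathrm{Aut}(\Gamma)({\bf x}))\cong\pi_1(F(X,n)/\mathrm{Aut}(\Gamma))$. In the second diagram, the vertical maps are induced by $i$ (a braid is regarded as a crossing-changeable braid), and the maps to $\mathrm{Aut}(\Gamma)$ send the class of the braid of $\alpha$ to $\sigma$ with $\alpha(1)={\bf x}_\sigma$. *)

(* Defs.v *)
From HB Require Import structures.
From mathcomp Require Import all_boot all_order all_algebra all_fingroup generic_quotient.
From mathcomp Require Import all_classical all_reals topology normedtype homotopy.
From mathcomp Require Import lra.
Set Implicit Arguments.
Unset Strict Implicit.
Unset Printing Implicit Defensive.
Import Order.TTheory GRing.Theory Num.Theory numFieldNormedType.Exports.
Local Open Scope classical_set_scope.
Local Open Scope ring_scope.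
Local Open Scope quotient_scope.

Section UnitInterval.
Context {R : realType}.

Definition unit_interval : Type := set_type `[0 : R, 1]%classic.

HB.instance Definition _ :=
  Topological.copy unit_interval (set_type `[0 : R, 1]%classic).

Lemma clamp_proof (r : R) : Num.max 0 (Num.min r 1) \in (`[0, 1]%classic : set R).
Proof. by rewrite inE /= in_itv /= le_max lexx /= ge_max ler01 ge_min lexx orbT. Qed.

(* Retraction of R onto [0, 1]; it lets one write a reparametrization such as
   s |-> 2 s as a total map into [0, 1]. *)
Definition clamp (r : R) : unit_interval := SigSub (clamp_proof r).

Definition ui_val (s : unit_interval) : R := val s.

Lemma ui_valP s : 0 <= ui_val s <= 1.
Proof. by have := valP s; rewrite inE /= in_itv. Qed.

Lemma ui_val_inj : injective ui_val.
Proof. by move=> s t /val_inj. Qed.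

Lemma clampE r : 0 <= r <= 1 -> ui_val (clamp r) = r.
Proof.
by move=> /andP[r0 r1]; rewrite /ui_val /= (min_idPl r1) (max_idPr r0).
Qed.

Lemma ui_val_continuous : continuous ui_val.
Proof. exact: initial_continuous. Qed.

Lemma clamp_continuous : continuous clamp.
Proof.
apply: continuous_comp_initial.
have cmin : continuous ((id : R -> R^o) \min cst 1).
  by move=> r; apply: continuous_min; [exact: cvg_id|exact: cvg_cst].
have cmax : continuous ((cst 0 : R -> R^o) \max (id \min cst 1)).
  by move=> r; apply: continuous_max; [exact: cvg_cst|exact: cmin].
exact: cmax.
Qed.

Fact clamp01_neq : clamp 0 != clamp 1.
Proof.
apply/eqP => /(congr1 ui_val); rewrite !clampE ?lexx ?ler01 // => /esym/eqP.
by rewrite oner_eq0.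
Qed.

HB.instance Definition _ := isBiPointed.Build unit_interval clamp01_neq.
End UnitInterval.
Arguments unit_interval R : clear implicits.

Section Homotopy.
Context {R : realType}.
Local Notation I := (unit_interval R).
Implicit Types (Y Z : topologicalType).

Definition path_cat {Y} (f g : I -> Y) (s : I) : Y :=
  if ui_val s <= 2^-1 then f (clamp (2 * ui_val s))
  else g (clamp (2 * ui_val s - 1)).

Definition path_rev {Y} (f : I -> Y) (s : I) : Y := f (clamp (1 - ui_val s)).

(* Homotopy rel the endpoints; the first coordinate of H is the path parameter. *)
Definition homotopic {Y} (f g : I -> Y) : Prop :=
  exists H : I * I -> Y,
    [/\ continuous H,
        forall s, H (s, zero) = f s,
        forall s, H (s, one) = g s,
        forall t, H (zero, t) = f zero &
        forall t, H (one, t) = f one].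

Lemma ui_val0 : ui_val (zero : I) = 0.
Proof. by rewrite clampE ?lexx ?ler01. Qed.

Lemma ui_val1 : ui_val (one : I) = 1.
Proof. by rewrite clampE ?lexx ?ler01. Qed.

Lemma clampK (s : I) : clamp (ui_val s) = s.
Proof. by apply: ui_val_inj; rewrite clampE// ui_valP. Qed.

Lemma clamp_le0 (r : R) : r <= 0 -> clamp r = zero.
Proof.
move=> r0; apply: ui_val_inj; rewrite ui_val0 /ui_val /=.
by apply/max_idPl; rewrite ge_min r0.
Qed.

Lemma clamp_ge1 (r : R) : 1 <= r -> clamp r = one.
Proof.
move=> r1; apply: ui_val_inj; rewrite ui_val1 /ui_val /= (min_idPr r1).
by apply/max_idPr; rewrite ler01.
Qed.

Lemma glue_continuous (T Y : topologicalType) (u : T -> R) (c : R) (f g : T -> Y) :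
  continuous u -> continuous f -> continuous g ->
  (forall p, u p = c -> f p = g p) ->
  continuous (fun p => if u p <= c then f p else g p).
Proof.
move=> cu cf cg fg p U hU.
rewrite /= !nbhs_simpl; change (\forall q \near p, U (if u q <= c then f q else g q)).
have [upc|upc|upc] := ltgtP (u p) c; rewrite /= in hU.
- have fU : \forall q \near p, U (f q) by apply: cf; move: hU; rewrite ltW.
  near=> q; rewrite ifT; first by near: q.
  by apply/ltW; near: q; exact: cvgr_lt (cu p) _ upc.
- have gU : \forall q \near p, U (g q) by apply: cg; move: hU; rewrite leNgt upc.
  near=> q; rewrite ifF; first by near: q.
  by apply/negbTE; rewrite -ltNge; near: q; exact: cvgr_gt (cu p) _ upc.
- rewrite upc lexx in hU; near=> q; case: ifP => _; near: q; first exact: cf.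
  by apply: cg; rewrite -(fg _ upc).
Unshelve. all: by end_near. Qed.

Lemma pair_continuous (T Y Z : topologicalType) (f : T -> Y) (g : T -> Z) :
  continuous f -> continuous g -> continuous (fun p => (f p, g p)).
Proof. by move=> cf cg p; apply: cvg_pair; [exact: cf|exact: cg]. Qed.

Lemma homotopic_refl Y (f : I -> Y) : continuous f -> homotopic f f.
Proof.
move=> cf; exists (fun p => f p.1); split => //.
by move=> p; apply: continuous_comp; [exact: cvg_fst|exact: cf].
Qed.

Lemma fst_cts (T U : topologicalType) : continuous (@fst T U).
Proof. by move=> p; exact: cvg_fst. Qed.

Lemma snd_cts (T U : topologicalType) : continuous (@snd T U).
Proof. by move=> p; exact: cvg_snd. Qed.

Lemma comp_cts (T U V : topologicalType) (f : T -> U) (g : U -> V) :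
  continuous f -> continuous g -> continuous (fun x => g (f x)).
Proof. by move=> cf cg x; apply: (@continuous_comp _ _ _ f); [exact: cf|exact: cg]. Qed.

Lemma cst_cts (T U : topologicalType) (c : U) : continuous (fun _ : T => c).
Proof. by move=> x; exact: cvg_cst. Qed.

Let ctn (T U : topologicalType) (f : T -> U) : Prop := continuous f.

Let ctnW (T U : topologicalType) (f : T -> U) : ctn f -> continuous f.
Proof. by []. Qed.

Let ctn_clamp (T : topologicalType) (u : T -> R) :
  ctn u -> ctn (fun p => clamp (u p)).
Proof. by move=> cu; apply: (comp_cts cu); exact: clamp_continuous. Qed.

Let ctn_val (T : topologicalType) (u : T -> I) :
  ctn u -> ctn (fun p => ui_val (u p)).
Proof. by move=> cu; apply: (comp_cts cu); exact: ui_val_continuous. Qed.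

Let ctn_add (T : topologicalType) (f g : T -> R) :
  ctn f -> ctn g -> ctn (fun p => f p + g p).
Proof. by move=> cf cg x; apply: cvgD; [exact: cf|exact: cg]. Qed.

Let ctn_mul (T : topologicalType) (f g : T -> R) :
  ctn f -> ctn g -> ctn (fun p => f p * g p).
Proof. by move=> cf cg x; apply: cvgM; [exact: cf|exact: cg]. Qed.

Let ctn_opp (T : topologicalType) (f : T -> R) :
  ctn f -> ctn (fun p => - f p).
Proof. by move=> cf x; apply: cvgN; exact: cf. Qed.

Let ctn_pair (T U V : topologicalType) (f : T -> U) (g : T -> V) :
  ctn f -> ctn g -> ctn (fun p => (f p, g p)).
Proof. exact: pair_continuous. Qed.

Let ctn_fst (T U : topologicalType) : ctn (fun p : T * U => p.1).
Proof. exact: fst_cts. Qed.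

Let ctn_snd (T U : topologicalType) : ctn (fun p : T * U => p.2).
Proof. exact: snd_cts. Qed.

Let ctn_cst (T U : topologicalType) (c : U) : ctn (fun _ : T => c).
Proof. exact: cst_cts. Qed.

Let ctn_id (T : topologicalType) : ctn (fun x : T => x).
Proof. by move=> x; exact: cvg_id. Qed.

Ltac cts_ := repeat lazymatch goal with
  | |- ctn fst => exact: ctn_fst
  | |- ctn snd => exact: ctn_snd
  | |- ctn ui_val => exact: ui_val_continuous
  | |- ctn (fun p => clamp (@?f p)) => apply: ctn_clamp
  | |- ctn (fun p => (@?f p, @?g p)) => apply: ctn_pair
  | |- ctn (fun p => ui_val (@?f p)) => apply: ctn_val
  | |- ctn (fun p => @?f p + @?g p) => apply: ctn_add
  | |- ctn (fun p => @?f p * @?g p) => apply: ctn_mul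
  | |- ctn (fun p => - @?f p) => apply: ctn_opp
  | |- ctn (fun p => ?x) => exact: ctn_cst
  | |- ctn (fun p => p) => exact: ctn_id
  | |- ctn _ => assumption
  end.
Ltac cts := apply: ctnW; cts_.

Lemma homotopic_sym Y (f g : I -> Y) : homotopic f g -> homotopic g f.
Proof.
move=> [H [cH H0 H1 Hz Ho]].
have c10 : clamp (1 - ui_val (zero : I)) = one by rewrite ui_val0 subr0.
have c11 : clamp (1 - ui_val (one : I)) = zero by rewrite ui_val1 subrr.
exists (fun p => H (p.1, clamp (1 - ui_val p.2))); split => [|s|s|t|t] /=.
- by apply: (comp_cts _ cH); cts.
- by rewrite c10.
- by rewrite c11.
- by rewrite Hz -(Hz one) H1.
- by rewrite Ho -(Ho one) H1.
Qed.

Lemma half01 : 0 <= (2^-1 : R) <= 1.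
Proof. by rewrite invr_ge0 ler0n invf_le1 ?ltr0n// ler1n. Qed.

Lemma glue_half (r : R) : r = 2^-1 -> clamp (2 * r) = one /\ clamp (2 * r - 1) = zero.
Proof. by move=> ->; rewrite mulfV ?pnatr_eq0// subrr. Qed.

Lemma homotopic_trans Y (f g h : I -> Y) :
  homotopic f g -> homotopic g h -> homotopic f h.
Proof.
move=> [H [cH H0 H1 Hz Ho]] [K [cK K0 K1 Kz Ko]].
exists (fun p => if ui_val p.2 <= 2^-1 then H (p.1, clamp (2 * ui_val p.2))
                 else K (p.1, clamp (2 * ui_val p.2 - 1))).
split => [|s|s|t|t] /=.
- apply: glue_continuous => [|||p /glue_half[-> ->]].
  + cts.
  + by apply: (comp_cts _ cH); cts.
  + by apply: (comp_cts _ cK); cts.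
  + by rewrite H1 K0.
- by rewrite ui_val0 (andP half01).1 mulr0.
- rewrite ui_val1 ifF; last by apply/negbTE; rewrite -ltNge invf_lt1 ?ltr0n ?ltr1n.
  by rewrite clamp_ge1 ?K1// mulr1 lerBrDr.
- by rewrite Hz Kz -(Hz one) H1; case: ifP.
- by rewrite Ho Ko -(Ho one) H1; case: ifP.
Qed.

Lemma homotopic_comp Y Z (k : Y -> Z) (f g : I -> Y) :
  continuous k -> homotopic f g -> homotopic (k \o f) (k \o g).
Proof.
move=> ck [H [cH H0 H1 Hz Ho]]; exists (k \o H).
split => [|s|s|t|t] /=; first exact: comp_cts.
- by rewrite H0.
- by rewrite H1.
- by rewrite Hz.
- by rewrite Ho.
Qed.

Lemma homotopic_end Y (f g : I -> Y) :
  homotopic f g -> f zero = g zero /\ f one = g one.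
Proof. by move=> [H [_ _ H1 Hz Ho]]; rewrite -(Hz one) -(Ho one) !H1. Qed.

Lemma homotopic_reparam Y (f : I -> Y) (phi psi : I -> I) :
  continuous f -> continuous phi -> continuous psi ->
  phi zero = psi zero -> phi one = psi one ->
  homotopic (f \o phi) (f \o psi).
Proof.
move=> cf cphi cpsi e0 e1; apply: homotopic_comp => //.
exists (fun p => clamp ((1 - ui_val p.2) * ui_val (phi p.1) +
                        ui_val p.2 * ui_val (psi p.1))).
have cphi1 : ctn (fun p : I * I => phi p.1) by apply: comp_cts => //; cts.
have cpsi1 : ctn (fun p : I * I => psi p.1) by apply: comp_cts => //; cts.
split => [|s|s|t|t] /=.
- by cts.
- by rewrite ui_val0 subr0 mul1r mul0r addr0 clampK.
- by rewrite ui_val1 subrr mul1r mul0r add0r clampK.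
- by rewrite -e0 -mulrDl subrK mul1r clampK.
- by rewrite -e1 -mulrDl subrK mul1r clampK.
Qed.

Lemma path_cat_continuous Y (f g : I -> Y) :
  continuous f -> continuous g -> f one = g zero -> continuous (path_cat f g).
Proof.
move=> cf cg fg; apply: glue_continuous => [|||p /glue_half[-> ->]//].
- exact: ui_val_continuous.
- by apply: (comp_cts _ cf); cts.
- by apply: (comp_cts _ cg); cts.
Qed.

Lemma path_cat0 Y (f g : I -> Y) : path_cat f g zero = f zero.
Proof. by rewrite /path_cat ui_val0 (andP half01).1 mulr0. Qed.

Lemma path_cat1 Y (f g : I -> Y) : path_cat f g one = g one.
Proof.
rewrite /path_cat ui_val1 ifF; last by apply/negbTE; rewrite -ltNge invf_lt1 ?ltr0n ?ltr1n.
by rewrite clamp_ge1// mulr1 lerBrDr.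
Qed.

Lemma path_rev0 Y (f : I -> Y) : path_rev f zero = f one.
Proof. by rewrite /path_rev ui_val0 subr0. Qed.

Lemma path_rev1 Y (f : I -> Y) : path_rev f one = f zero.
Proof. by rewrite /path_rev ui_val1 subrr. Qed.

Lemma path_rev_continuous Y (f : I -> Y) : continuous f -> continuous (path_rev f).
Proof. by move=> cf; apply: (comp_cts _ cf); cts. Qed.

Lemma path_revK Y (f : I -> Y) : path_rev (path_rev f) = f.
Proof.
apply/funext => s; rewrite /path_rev clampE ?subKr ?clampK//.
by rewrite subr_ge0 lerBlDr lerDl andbC; exact: ui_valP.
Qed.

Lemma path_cat_comp Y Z (k : Y -> Z) (f g : I -> Y) :
  k \o path_cat f g = path_cat (k \o f) (k \o g).
Proof. by apply/funext => s; rewrite /path_cat /=; case: ifP. Qed.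

Lemma path_rev_comp Y Z (k : Y -> Z) (f : I -> Y) :
  k \o path_rev f = path_rev (k \o f).
Proof. by []. Qed.

Lemma homotopic_cat Y (f f' g g' : I -> Y) : f one = g zero ->
  homotopic f f' -> homotopic g g' -> homotopic (path_cat f g) (path_cat f' g').
Proof.
move=> fg [H [cH H0 H1 Hz Ho]] [K [cK K0 K1 Kz Ko]].
exists (fun p => if ui_val p.1 <= 2^-1 then H (clamp (2 * ui_val p.1), p.2)
                 else K (clamp (2 * ui_val p.1 - 1), p.2)).
split => [|s|s|t|t].
- apply: glue_continuous => [|||p /glue_half[-> ->]].
  + cts.
  + by apply: (comp_cts _ cH); cts.
  + by apply: (comp_cts _ cK); cts.
  + by rewrite Ho Kz.
- by rewrite /path_cat H0 K0.
- by rewrite /path_cat H1 K1.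
- by rewrite path_cat0 /= ui_val0 (andP half01).1 mulr0 Hz.
- rewrite path_cat1 /= ui_val1 ifF; last first.
    by apply/negbTE; rewrite -ltNge invf_lt1 ?ltr0n ?ltr1n.
  by rewrite clamp_ge1 ?Ko// mulr1 lerBrDr.
Qed.

Lemma homotopic_rev Y (f g : I -> Y) :
  homotopic f g -> homotopic (path_rev f) (path_rev g).
Proof.
move=> [H [cH H0 H1 Hz Ho]].
exists (fun p => H (clamp (1 - ui_val p.1), p.2)); split => [|s|s|t|t] /=.
- by apply: (comp_cts _ cH); cts.
- by rewrite H0.
- by rewrite H1.
- by rewrite ui_val0 subr0 Ho path_rev0.
- by rewrite ui_val1 subrr Hz path_rev1.
Qed.

Lemma homotopic_reparam_id Y (f : I -> Y) (phi : I -> I) :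
  continuous f -> continuous phi -> phi zero = zero -> phi one = one ->
  homotopic (f \o phi) f.
Proof.
by move=> cf cphi e0 e1; apply: (homotopic_reparam cf cphi _ e0 e1); cts.
Qed.

Lemma homotopic_cstl Y (f : I -> Y) : continuous f ->
  homotopic (path_cat (cst (f zero)) f) f.
Proof.
move=> cf.
have -> : path_cat (cst (f zero)) f = f \o (fun s => clamp (2 * ui_val s - 1)).
  apply/funext => s; rewrite /path_cat /=; case: ifP => // s2.
  rewrite [clamp (_ - 1)]clamp_le0// subr_le0.
  by move: s2; rewrite -[2^-1]mul1r ler_pdivlMr ?ltr0n// mulrC.
apply: homotopic_reparam_id => //; first cts.
- by rewrite clamp_le0// ui_val0 mulr0 sub0r oppr_le0.
- by rewrite clamp_ge1// ui_val1 mulr1 lerBrDr.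
Qed.

Lemma homotopic_cstr Y (f : I -> Y) : continuous f ->
  homotopic (path_cat f (cst (f one))) f.
Proof.
move=> cf.
have -> : path_cat f (cst (f one)) = f \o (fun s => clamp (2 * ui_val s)).
  apply/funext => s; rewrite /path_cat /=; case: ifP => // /negbT.
  rewrite -ltNge -[2^-1]mul1r ltr_pdivrMr ?ltr0n// mulrC => s2.
  by rewrite [clamp (2 * _)]clamp_ge1// ltW.
apply: homotopic_reparam_id => //; first cts.
- by rewrite clamp_le0// ui_val0 mulr0.
- by rewrite clamp_ge1// ui_val1 mulr1 ler1n.
Qed.

Lemma homotopic_catV Y (f : I -> Y) : continuous f ->
  homotopic (path_cat f (path_rev f)) (cst (f zero)).
Proof.
move=> cf.
pose phi (s : I) : I := if ui_val s <= 2^-1 then clamp (2 * ui_val s) else clamp (2 - 2 * ui_val s).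
have -> : path_cat f (path_rev f) = f \o phi.
  apply/funext => s; rewrite /path_cat /phi /=; case: ifP => // /negbT.
  rewrite -ltNge -[2^-1]mul1r ltr_pdivrMr ?ltr0n// mulrC => s2.
  have /andP[s0 s1] := ui_valP s.
  rewrite /path_rev clampE ?opprB ?addrA//.
  by rewrite subr_ge0 ltW//= lerBlDr ler_piMr.
have -> : cst (f zero) = f \o cst zero by [].
apply: homotopic_reparam => //.
- apply: glue_continuous; [cts..|].
  by move=> p ->; congr (clamp _); lra.
- exact: cst_cts.
- by rewrite /phi ui_val0 (andP half01).1 mulr0.
- rewrite /phi ui_val1 ifF; last by apply/negbTE; rewrite -ltNge invf_lt1 ?ltr0n ?ltr1n.
  by rewrite mulr1 subrr.
Qed.

Lemma homotopic_Vcat Y (f : I -> Y) : continuous f ->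
  homotopic (path_cat (path_rev f) f) (cst (f one)).
Proof.
move=> /path_rev_continuous/homotopic_catV.
by rewrite path_revK path_rev0.
Qed.

Lemma homotopic_catA Y (f g h : I -> Y) :
  continuous f -> continuous g -> continuous h ->
  f one = g zero -> g one = h zero ->
  homotopic (path_cat (path_cat f g) h) (path_cat f (path_cat g h)).
Proof.
move=> cf cg ch fg gh.
pose phi (s : I) : I := if ui_val s <= 2^-1 then
  (if ui_val s <= 4^-1 then clamp (2 * ui_val s) else clamp (ui_val s + 4^-1))
  else clamp (2^-1 * ui_val s + 2^-1).
have cfgh : continuous (path_cat f (path_cat g h)).
  by apply: path_cat_continuous; rewrite ?path_cat0//; exact: path_cat_continuous.
have -> : path_cat (path_cat f g) h = path_cat f (path_cat g h) \o phi.
  apply/funext => s; have /andP[s0 s1] := ui_valP s.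
  rewrite /= {1}/path_cat; case: ifPn => [s2|]; last rewrite -ltNge => s2.
    rewrite {1}/path_cat clampE; last lra.
    case: ifPn => [s4|]; last rewrite -ltNge => s4.
      have -> : phi s = clamp (2 * ui_val s) by rewrite /phi s2 ifT//; lra.
      by rewrite /path_cat clampE ?ifT//; lra.
    have -> : phi s = clamp (ui_val s + 4^-1).
      by rewrite /phi s2 ifF//; apply/negbTE; rewrite -ltNge; lra.
    rewrite /path_cat clampE; last lra.
    rewrite ifF; last by apply/negbTE; rewrite -ltNge; lra.
    rewrite clampE; last lra.
    rewrite ifT; last by lra.
    by congr (g (clamp _)); lra.
  have -> : phi s = clamp (2^-1 * ui_val s + 2^-1).
    by rewrite /phi ifF//; apply/negbTE; rewrite -ltNge.
  rewrite /path_cat clampE; last lra.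
  rewrite ifF; last by apply/negbTE; rewrite -ltNge; lra.
  rewrite clampE; last lra.
  rewrite ifF; last by apply/negbTE; rewrite -ltNge; lra.
  by congr (h (clamp _)); lra.
apply: homotopic_reparam_id => //.
- apply: glue_continuous; [by cts| |by cts|].
    apply: glue_continuous; [by cts..|].
    by move=> p ->; congr (clamp _); lra.
  by move=> p ->; rewrite ifF; [congr (clamp _); lra|apply/negbTE; rewrite -ltNge; lra].
- by rewrite /phi ui_val0 !ifT; [rewrite mulr0|lra..].
- rewrite /phi ui_val1 ifF; last by apply/negbTE; rewrite -ltNge; lra.
  by rewrite mulr1; congr (clamp _); lra.
Qed.

End Homotopy.

Section FundamentalGroup.
Context {R : realType} {Y : topologicalType} (x : Y).
Local Notation I := (unit_interval R).
Local Notation loop := {path I from x to x in Y}.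
Implicit Types a b c : loop.

Let loop_homotopic a b := `[< homotopic a b >].

Let loop_homotopic_refl : reflexive loop_homotopic.
Proof. by move=> a; apply/asboolP/homotopic_refl/cts_fun. Qed.

Let loop_homotopic_sym : symmetric loop_homotopic.
Proof.
by move=> a b; apply/asboolP/asboolP => /homotopic_sym.
Qed.

Let loop_homotopic_trans : transitive loop_homotopic.
Proof.
move=> b a c /asboolP ab /asboolP bc; apply/asboolP.
exact: homotopic_trans bc.
Qed.

Definition loop_homotopic_rel :=
  EquivRel _ loop_homotopic_refl loop_homotopic_sym loop_homotopic_trans.

Definition pi1 : Type := {eq_quot loop_homotopic_rel}.

HB.instance Definition _ := Choice.on pi1.

Definition pi1_class a : pi1 := \pi_({eq_quot loop_homotopic_rel}) a.
Definition pi1_repr (u : pi1) : loop := repr (u : {eq_quot loop_homotopic_rel}).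

Lemma pi1_classK u : pi1_class (pi1_repr u) = u.
Proof. exact: reprK. Qed.

Lemma pi1_classP a b : pi1_class a = pi1_class b <-> homotopic a b.
Proof.
split=> [/eqmodP/asboolP//|ab]; exact/eqmodP/asboolP.
Qed.

Lemma pi1_reprP a : homotopic (pi1_repr (pi1_class a)) a.
Proof. by apply/pi1_classP; rewrite pi1_classK. Qed.

Let loop_cts a : continuous a.
Proof. exact: cts_fun. Qed.

Let loop_cat_cts a b : continuous (path_cat a b).
Proof.
by apply: path_cat_continuous; [exact: cts_fun..|rewrite path_one path_zero].
Qed.

Definition loop_cat a b : loop := mk_path (@loop_cat_cts a b)
  (etrans (path_cat0 a b) path_zero) (etrans (path_cat1 a b) path_one).

Definition loop_rev a : loop := mk_path (path_rev_continuous (@cts_fun _ _ a))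
  (etrans (path_rev0 a) path_one) (etrans (path_rev1 a) path_zero).

Definition loop_cst : loop := cst x.

Definition pi1_mul (u v : pi1) := pi1_class (loop_cat (pi1_repr u) (pi1_repr v)).
Definition pi1_inv (u : pi1) := pi1_class (loop_rev (pi1_repr u)).
Definition pi1_one := pi1_class loop_cst.

Let pi1_ind (P : pi1 -> Prop) : (forall a, P (pi1_class a)) -> forall u, P u.
Proof. by move=> Pc u; rewrite -(pi1_classK u). Qed.

Lemma pi1_mulE a b : pi1_mul (pi1_class a) (pi1_class b) = pi1_class (loop_cat a b).
Proof.
apply/pi1_classP; apply: homotopic_cat; [|exact: pi1_reprP..].
by rewrite path_one path_zero.
Qed.

Lemma pi1_invE a : pi1_inv (pi1_class a) = pi1_class (loop_rev a).
Proof. by apply/pi1_classP; apply: homotopic_rev; exact: pi1_reprP. Qed.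

Let pi1_mulA : associative pi1_mul.
Proof.
elim/pi1_ind => a; elim/pi1_ind => b; elim/pi1_ind => c; rewrite !pi1_mulE.
apply/pi1_classP/homotopic_sym; apply: homotopic_catA; [exact: cts_fun..| |];
  by rewrite path_one path_zero.
Qed.

Let pi1_mul1g : left_id pi1_one pi1_mul.
Proof.
elim/pi1_ind => a; rewrite pi1_mulE; apply/pi1_classP.
by have := homotopic_cstl (@loop_cts a); rewrite path_zero.
Qed.

Let pi1_mulg1 : right_id pi1_one pi1_mul.
Proof.
elim/pi1_ind => a; rewrite pi1_mulE; apply/pi1_classP.
by have := homotopic_cstr (@loop_cts a); rewrite path_one.
Qed.

Let pi1_mulgV : right_inverse pi1_one pi1_inv pi1_mul.
Proof.
elim/pi1_ind => a; rewrite pi1_invE pi1_mulE; apply/pi1_classP.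
by have := homotopic_catV (@loop_cts a); rewrite path_zero.
Qed.

Let pi1_mulVg : left_inverse pi1_one pi1_inv pi1_mul.
Proof.
elim/pi1_ind => a; rewrite pi1_invE pi1_mulE; apply/pi1_classP.
by have := homotopic_Vcat (@loop_cts a); rewrite path_one.
Qed.

HB.instance Definition _ := isGroup.Build pi1
  pi1_mulA pi1_mul1g pi1_mulg1 pi1_mulVg pi1_mulgV.

End FundamentalGroup.
Arguments pi1 R {Y} x.

Section FundamentalGroupMap.
Context {R : realType} {Y Z : topologicalType} (f : continuousType Y Z) (x : Y).
Local Notation I := (unit_interval R).

Definition pi1_map (u : pi1 R x) : pi1 R (f x) :=
  pi1_class ((f \o pi1_repr u) : {path I from f x to f x in Z}).

Lemma pi1_mapE (a : {path I from x to x in Y}) :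
  pi1_map (pi1_class a) = pi1_class ((f \o a) : {path I from f x to f x in Z}).
Proof.
by apply/pi1_classP; apply: homotopic_comp; [exact: cts_fun|exact: pi1_reprP].
Qed.
End FundamentalGroupMap.
Arguments pi1_map R {Y Z} f x u.

Definition homeomorphic (T U : topologicalType) : Prop :=
  exists (f : T -> U) (g : U -> T),
    [/\ continuous f, continuous g, cancel f g & cancel g f].

(* Manifolds are without boundary; the dimension m is the same at all points. *)
Definition topological_manifold (R : realType) (m : nat) (X : topologicalType) : Prop :=
  [/\ hausdorff_space X, @second_countable X &
      forall p : X, exists (U : set X) (V : set 'rV[R]_m),
        [/\ open U, U p, open V & homeomorphic U V]].

Record simple_graph (n : nat) := SimpleGraph {
  adj :> rel 'I_n;
  adj_sym : symmetric adj;
  adj_irr : irreflexive adj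
}.

Program Definition complete_graph n : simple_graph n :=
  @SimpleGraph n (fun j k => j != k) _ _.
Next Obligation. by move=> n j k; rewrite eq_sym. Qed.
Next Obligation. by move=> n j; rewrite eqxx. Qed.

(* The product of 'S_n is read left to right, (s * t) j = t (s j) (permM). *)
Definition Aut_set n (Gam : simple_graph n) : {set 'S_n} :=
  [set s : 'S_n | [forall j, forall k, Gam (s j) (s k) == Gam j k]]%SET.

Lemma Aut_setP n (Gam : simple_graph n) (s : 'S_n) :
  reflect (forall j k, Gam (s j) (s k) = Gam j k) (s \in Aut_set Gam).
Proof.
rewrite inE; apply: (iffP forallP) => [h j k|h j].
  by have /forallP/(_ k)/eqP := h j.
by apply/forallP => k; rewrite h.
Qed.

Lemma Aut_group_set n (Gam : simple_graph n) : group_set (Aut_set Gam).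
Proof.
apply/group_setP; split=> [|s t /Aut_setP hs /Aut_setP ht]; apply/Aut_setP => j k.
  by rewrite !perm1.
by rewrite !permM ht hs.
Qed.

Definition Aut n (Gam : simple_graph n) : {group 'S_n} := Group (Aut_group_set Gam).

Lemma Aut_complete n (Gam : simple_graph n) : Aut Gam \subset Aut (complete_graph n).
Proof.
by apply/fintype.subsetP => s _; apply/Aut_setP => j k /=; rewrite (inj_eq perm_inj).
Qed.

Lemma Aut_refl n (Gam : simple_graph n) : Aut Gam \subset Aut Gam.
Proof. exact: fintype.subxx. Qed.

Section ConfigurationSpace.
Context {X : topologicalType} {n : nat}.

Definition conf (Gam : simple_graph n) : set {ptws 'I_n -> X} :=
  [set x | forall j k, Gam j k -> x j <> x k].

Definition coord (Gam : simple_graph n) (x : conf Gam) (i : 'I_n) : X := val x i.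

Definition mk_conf (Gam : simple_graph n) (x : 'I_n -> X)
  (hx : forall j k, Gam j k -> x j <> x k) : conf Gam := SigSub (mem_set hx).

Lemma coord_neq (Gam : simple_graph n) (x : conf Gam) j k :
  Gam j k -> coord x j <> coord x k.
Proof. by have /set_mem := valP x; apply. Qed.

Lemma conf_eqP (Gam : simple_graph n) (x y : conf Gam) :
  coord x =1 coord y -> x = y.
Proof. by move=> xy; apply: val_inj; exact/funext. Qed.

Lemma coord_continuous (Gam : simple_graph n) i : continuous (fun x : conf Gam => coord x i).
Proof.
move=> x; apply: (@continuous_comp (conf Gam) {ptws 'I_n -> X} X val (fun y => y i)).
  exact: initial_continuous.
exact: (@proj_continuous 'I_n (fun _ => X) i).
Qed.

Lemma conf_continuous (T : topologicalType) (Gam : simple_graph n) (f : T -> conf Gam) :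
  (forall i, continuous (fun t => coord (f t) i)) -> continuous f.
Proof.
move=> hf; apply: continuous_comp_initial => t.
apply/cvg_sup => i U [V [[W oW <-]] /= Wfi VU].
rewrite /= !nbhs_simpl; apply: filterS VU _.
by apply: (hf i t); exact: open_nbhs_nbhs.
Qed.

Lemma coord_complete_inj (x : conf (complete_graph n)) : injective (coord x).
Proof. by move=> j k; apply: contra_eq => jk; apply/eqP/coord_neq. Qed.

Lemma conf_incl_proof (Gam : simple_graph n) (x : conf (complete_graph n)) j k :
  Gam j k -> coord x j <> coord x k.
Proof. by move=> jk /coord_complete_inj ejk; rewrite ejk adj_irr in jk. Qed.

Definition conf_incl (Gam : simple_graph n) (x : conf (complete_graph n)) : conf Gam :=
  mk_conf (@conf_incl_proof Gam x).

Lemma conf_incl_continuous (Gam : simple_graph n) : continuous (conf_incl Gam).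
Proof. by apply: conf_continuous => i; exact: coord_continuous. Qed.

HB.instance Definition _ (Gam : simple_graph n) :=
  isContinuous.Build _ _ (conf_incl Gam) (@conf_incl_continuous Gam).

Section Action.
Context {Gam : simple_graph n} {G : {group 'S_n}} (sG : G \subset Aut Gam).

Lemma conf_act_proof (s : [subg G]) (x : conf Gam) j k :
  Gam j k -> coord x (sgval s j) <> coord x (sgval s k).
Proof.
have /Aut_setP sA := fintype.subsetP sG _ (subgP s).
by rewrite -sA; exact: coord_neq.
Qed.

(* (x_s)_i = x_(s i).  With left-to-right products this is a left action, see
   conf_actM. *)
Definition conf_act (s : [subg G]) (x : conf Gam) : conf Gam :=
  mk_conf (@conf_act_proof s x).

Lemma conf_act_continuous s : continuous (conf_act s).
Proof. by apply: conf_continuous => i; exact: coord_continuous. Qed.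

Lemma conf_act1 x : conf_act 1%g x = x.
Proof. by apply: conf_eqP => i; rewrite /coord /= perm1. Qed.

Lemma conf_actM s t x : conf_act s (conf_act t x) = conf_act (s * t)%g x.
Proof. by apply: conf_eqP => i; rewrite /coord /= permM. Qed.

Lemma conf_act_inj s t x : injective (coord x) -> conf_act s x = conf_act t x -> s = t.
Proof.
move=> injx e; apply/val_inj/permP => i; apply: injx.
exact: (congr1 (fun y => coord y i) e).
Qed.
End Action.
End ConfigurationSpace.
Arguments conf X {n} Gam.
Arguments coord_complete_inj {X n} x [_ _] _.
Arguments conf_act {X n Gam G} sG s x.
Arguments conf_incl {X n} Gam x.

Section ExtendedPaths.
Context {R : realType} {X : topologicalType} {n : nat} {Gam : simple_graph n}.
Context {G : {group 'S_n}} (sG : G \subset Aut Gam) (x : conf X Gam).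
Local Notation I := (unit_interval R).
Local Notation act := (@conf_act X n Gam G sG).

(* Paths from x to a point of the orbit G(x). *)
Record ext_path := ExtPath {
  ep_fun :> I -> conf X Gam;
  ep_continuous : continuous ep_fun;
  ep_start : ep_fun zero = x;
  ep_end : exists s : [subg G], ep_fun one = act s x
}.

HB.instance Definition _ := gen_eqMixin ext_path.
HB.instance Definition _ := gen_choiceMixin ext_path.

(* Some s with a one = x_s; it is unique when the coordinates of x are pairwise
   distinct (ep_perm_eq). *)
Definition ep_perm (a : ext_path) : [subg G] := projT1 (cid (ep_end a)).

Lemma ep_permP (a : ext_path) : a one = act (ep_perm a) x.
Proof. exact: (projT2 (cid (ep_end a))). Qed.

Let ep_cat_mid (a b : ext_path) :
  a one = (act (ep_perm a) \o b) zero.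
Proof. by rewrite /= ep_start ep_permP. Qed.

Let ep_act_cts (s : [subg G]) (f : I -> conf X Gam) :
  continuous f -> continuous (act s \o f).
Proof. by move=> cf; apply: comp_cts => //; exact: conf_act_continuous. Qed.

Let ep_cat_cts (a b : ext_path) :
  continuous (path_cat a (act (ep_perm a) \o b)).
Proof.
by apply: path_cat_continuous => //; [|apply: ep_act_cts]; exact: ep_continuous.
Qed.

Let ep_cat_end (a b : ext_path) :
  path_cat a (act (ep_perm a) \o b) one =
  act (ep_perm a * ep_perm b)%g x.
Proof. by rewrite path_cat1 /= ep_permP conf_actM. Qed.

(* [a] . [b] = [a o b_s], where a one = x_s. *)
Definition ep_cat (a b : ext_path) : ext_path :=
  ExtPath (@ep_cat_cts a b) (etrans (path_cat0 _ _) (ep_start a))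
    (ex_intro _ _ (ep_cat_end a b)).

Let ep_rev_start (a : ext_path) :
  (act (ep_perm a)^-1%g \o path_rev a) zero = x.
Proof. by rewrite /= path_rev0 ep_permP conf_actM mulVg conf_act1. Qed.

Let ep_rev_end (a : ext_path) :
  (act (ep_perm a)^-1%g \o path_rev a) one =
  act (ep_perm a)^-1%g x.
Proof. by rewrite /= path_rev1 ep_start. Qed.

Definition ep_rev (a : ext_path) : ext_path :=
  ExtPath (ep_act_cts (path_rev_continuous (@ep_continuous a)))
    (ep_rev_start a) (ex_intro _ _ (ep_rev_end a)).

Definition ep_cst : ext_path :=
  @ExtPath (cst x) (@cst_cts _ _ x) (erefl x) (ex_intro _ 1%g (esym (conf_act1 sG x))).

Let loop_end (a : {path I from x to x in conf X Gam}) :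
  exists s, a one = act s x.
Proof. by exists 1%g; rewrite path_one conf_act1. Qed.

Definition ep_of_loop (a : {path I from x to x in conf X Gam}) : ext_path :=
  ExtPath (@cts_fun _ _ a) path_zero (loop_end a).

Context (injx : injective (coord x)).

Lemma ep_perm_eq (a : ext_path) s : a one = act s x -> ep_perm a = s.
Proof. by rewrite ep_permP => /conf_act_inj; exact. Qed.

Lemma ep_perm_homotopic (a b : ext_path) : homotopic a b -> ep_perm a = ep_perm b.
Proof. by case/homotopic_end => _ ab; apply: ep_perm_eq; rewrite ab ep_permP. Qed.

Lemma ep_perm_cat a b : ep_perm (ep_cat a b) = (ep_perm a * ep_perm b)%g.
Proof. exact: (@ep_perm_eq (ep_cat a b) _ (@ep_cat_end a b)). Qed.

Lemma ep_perm_rev a : ep_perm (ep_rev a) = (ep_perm a)^-1%g.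
Proof. exact: (@ep_perm_eq (ep_rev a) _ (@ep_rev_end a)). Qed.

Lemma ep_perm_cst : ep_perm ep_cst = 1%g.
Proof. by apply: ep_perm_eq; rewrite conf_act1. Qed.

Lemma ep_cat_homotopic (a a' b b' : ext_path) :
  homotopic a a' -> homotopic b b' -> homotopic (ep_cat a b) (ep_cat a' b').
Proof.
move=> aa' bb'; apply: homotopic_cat; first exact: ep_cat_mid.
  by [].
rewrite -(ep_perm_homotopic aa'); apply: homotopic_comp bb'.
exact: conf_act_continuous.
Qed.

Lemma ep_rev_homotopic (a a' : ext_path) :
  homotopic a a' -> homotopic (ep_rev a) (ep_rev a').
Proof.
move=> aa' /=; rewrite -(ep_perm_homotopic aa'); apply: homotopic_comp.
  exact: conf_act_continuous.
exact: homotopic_rev.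
Qed.

Lemma ep_catA (a b c : ext_path) :
  homotopic (ep_cat a (ep_cat b c)) (ep_cat (ep_cat a b) c).
Proof.
apply: homotopic_sym.
have := @homotopic_catA _ _ a (act (ep_perm a) \o b)
  (act (ep_perm a * ep_perm b)%g \o c).
have -> : ep_cat (ep_cat a b) c = path_cat (path_cat a (act (ep_perm a) \o b))
    (act (ep_perm a * ep_perm b)%g \o c) :> (I -> _).
  by rewrite /= ep_perm_cat.
have -> : ep_cat a (ep_cat b c) = path_cat a (path_cat (act (ep_perm a) \o b)
    (act (ep_perm a * ep_perm b)%g \o c)) :> (I -> _).
  rewrite /= path_cat_comp; congr (path_cat _ (path_cat _ _)).
  by apply/funext => s /=; rewrite conf_actM.
apply; do ?[apply: ep_act_cts]; try exact: ep_continuous.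
  exact: ep_cat_mid.
by rewrite /= ep_permP ep_start conf_actM.
Qed.

Lemma ep_cst_cat a : homotopic (ep_cat ep_cst a) a.
Proof.
have := homotopic_cstl (@ep_continuous a); rewrite ep_start.
rewrite [X in _ -> homotopic X _](_ : _ = path_cat (cst x) a)//=.
by rewrite ep_perm_cst; congr (path_cat _ _); apply/funext => s /=; rewrite conf_act1.
Qed.

Lemma ep_cat_cst a : homotopic (ep_cat a ep_cst) a.
Proof.
have := homotopic_cstr (@ep_continuous a); rewrite ep_permP.
by [].
Qed.

Lemma ep_cat_rev a : homotopic (ep_cat a (ep_rev a)) ep_cst.
Proof.
have := homotopic_catV (@ep_continuous a); rewrite ep_start.
rewrite [X in _ -> homotopic X _](_ : _ = path_cat a (path_rev a))//=.
by congr (path_cat _ _); apply/funext => s /=; rewrite conf_actM mulgV conf_act1.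
Qed.

Lemma ep_rev_cat a : homotopic (ep_cat (ep_rev a) a) ep_cst.
Proof.
have := homotopic_Vcat (@ep_continuous a); rewrite ep_permP.
move=> /(homotopic_comp (@conf_act_continuous X n Gam G sG (ep_perm a)^-1%g)).
rewrite path_cat_comp.
rewrite (_ : _ \o cst _ = cst x); last first.
  by apply/funext => s /=; rewrite conf_actM mulVg conf_act1.
by rewrite /= ep_perm_rev.
Qed.

End ExtendedPaths.
Arguments ext_path R {X n Gam G} sG x.
Arguments ep_cst {R X n Gam G} sG x.

Section ExtendedFundamentalGroup.
Context {R : realType} {X : topologicalType} {n : nat} {Gam : simple_graph n}.
Context {G : {group 'S_n}} (sG : G \subset Aut Gam) {x : conf X Gam}.
Context (injx : injective (coord x)).
Local Notation ext_path := (ext_path R sG x).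
Implicit Types a b c : ext_path.

Let ep_homotopic a b := `[< homotopic a b >].

Let ep_homotopic_refl : reflexive ep_homotopic.
Proof. by move=> a; apply/asboolP/homotopic_refl/ep_continuous. Qed.

Let ep_homotopic_sym : symmetric ep_homotopic.
Proof. by move=> a b; apply/asboolP/asboolP => /homotopic_sym. Qed.

Let ep_homotopic_trans : transitive ep_homotopic.
Proof.
by move=> b a c /asboolP ab /asboolP bc; apply/asboolP/(homotopic_trans ab).
Qed.

Definition ep_homotopic_rel :=
  EquivRel _ ep_homotopic_refl ep_homotopic_sym ep_homotopic_trans.

(* pi_1^E(F(X, Gam), x, G(x)).  Injectivity of the coordinates of x is not used
   by the carrier, but the group structure needs it, since the operation refers
   to the permutation of the first path. *)
Definition pi1E (_ : injective (coord x)) : Type := {eq_quot ep_homotopic_rel}.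

HB.instance Definition _ := Choice.on (pi1E injx).

Definition pi1E_class a : pi1E injx := \pi_({eq_quot ep_homotopic_rel}) a.
Definition pi1E_repr (u : pi1E injx) : ext_path := repr (u : {eq_quot ep_homotopic_rel}).

Lemma pi1E_classK u : pi1E_class (pi1E_repr u) = u.
Proof. exact: reprK. Qed.

Lemma pi1E_classP a b : pi1E_class a = pi1E_class b <-> homotopic a b.
Proof. by split=> [/eqmodP/asboolP//|ab]; exact/eqmodP/asboolP. Qed.

Lemma pi1E_reprP a : homotopic (pi1E_repr (pi1E_class a)) a.
Proof. by apply/pi1E_classP; rewrite pi1E_classK. Qed.

Definition pi1E_mul (u v : pi1E injx) := pi1E_class (ep_cat (pi1E_repr u) (pi1E_repr v)).
Definition pi1E_inv (u : pi1E injx) := pi1E_class (ep_rev (pi1E_repr u)).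
Definition pi1E_one := pi1E_class (ep_cst sG x).

Let pi1E_ind (P : pi1E injx -> Prop) : (forall a, P (pi1E_class a)) -> forall u, P u.
Proof. by move=> Pc u; rewrite -(pi1E_classK u). Qed.

Lemma pi1E_mulE a b : pi1E_mul (pi1E_class a) (pi1E_class b) = pi1E_class (ep_cat a b).
Proof. by apply/pi1E_classP; apply: ep_cat_homotopic => //; exact: pi1E_reprP. Qed.

Lemma pi1E_invE a : pi1E_inv (pi1E_class a) = pi1E_class (ep_rev a).
Proof. by apply/pi1E_classP; apply: ep_rev_homotopic => //; exact: pi1E_reprP. Qed.

Let pi1E_mulA : associative pi1E_mul.
Proof.
elim/pi1E_ind => a; elim/pi1E_ind => b; elim/pi1E_ind => c; rewrite !pi1E_mulE.
exact/pi1E_classP/ep_catA.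
Qed.

Let pi1E_mul1g : left_id pi1E_one pi1E_mul.
Proof. by elim/pi1E_ind => a; rewrite pi1E_mulE; exact/pi1E_classP/ep_cst_cat. Qed.

Let pi1E_mulg1 : right_id pi1E_one pi1E_mul.
Proof. by elim/pi1E_ind => a; rewrite pi1E_mulE; exact/pi1E_classP/ep_cat_cst. Qed.

Let pi1E_mulgV : right_inverse pi1E_one pi1E_inv pi1E_mul.
Proof.
by elim/pi1E_ind => a; rewrite pi1E_invE pi1E_mulE; exact/pi1E_classP/ep_cat_rev.
Qed.

Let pi1E_mulVg : left_inverse pi1E_one pi1E_inv pi1E_mul.
Proof.
by elim/pi1E_ind => a; rewrite pi1E_invE pi1E_mulE; exact/pi1E_classP/ep_rev_cat.
Qed.

HB.instance Definition _ := isGroup.Build (pi1E injx)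
  pi1E_mulA pi1E_mul1g pi1E_mulg1 pi1E_mulVg pi1E_mulgV.

Definition pi1E_perm (u : pi1E injx) : [subg G] := ep_perm (pi1E_repr u).

Lemma pi1E_permE a : pi1E_perm (pi1E_class a) = ep_perm a.
Proof. by apply: ep_perm_homotopic => //; exact: pi1E_reprP. Qed.

Definition pi1_pi1E (u : pi1 R x) : pi1E injx := pi1E_class (ep_of_loop sG (pi1_repr u)).

Lemma pi1_pi1EE (a : {path (unit_interval R) from x to x}) :
  pi1_pi1E (pi1_class a) = pi1E_class (ep_of_loop sG a).
Proof. by apply/pi1E_classP; exact: pi1_reprP. Qed.

End ExtendedFundamentalGroup.
Arguments pi1E R {X n Gam G} sG {x} injx.
Arguments pi1E_perm R {X n Gam G} sG {x} injx u.
Arguments pi1_pi1E R {X n Gam G} sG {x} injx u.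

Section ExtendedInclusion.
Context {R : realType} {X : topologicalType} {n : nat} (Gam : simple_graph n).
Context {G : {group 'S_n}} (sGK : G \subset Aut (complete_graph n)).
Context (sG : G \subset Aut Gam) (x : conf X (complete_graph n)).

Lemma conf_incl_act s (y : conf X (complete_graph n)) :
  conf_incl Gam (conf_act sGK s y) = conf_act sG s (conf_incl Gam y).
Proof. exact: conf_eqP. Qed.

Let ep_incl_cts (a : ext_path R sGK x) : continuous (conf_incl Gam \o a).
Proof. by apply: comp_cts; [exact: ep_continuous|exact: conf_incl_continuous]. Qed.

Let ep_incl_start (a : ext_path R sGK x) :
  (conf_incl Gam \o a) zero = conf_incl Gam x.
Proof. by rewrite /= ep_start. Qed.

Let ep_incl_end (a : ext_path R sGK x) :
  exists s, (conf_incl Gam \o a) one = conf_act sG s (conf_incl Gam x).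
Proof. by exists (ep_perm a); rewrite /= ep_permP conf_incl_act. Qed.

Definition ep_incl (a : ext_path R sGK x) : ext_path R sG (conf_incl Gam x) :=
  ExtPath (@ep_incl_cts a) (ep_incl_start a) (ep_incl_end a).

Context (injx : injective (coord x)) (injx' : injective (coord (conf_incl Gam x))).

Definition pi1E_incl (u : pi1E R sGK injx) : pi1E R sG injx' :=
  pi1E_class injx' (ep_incl (pi1E_repr u)).

Lemma pi1E_inclE a :
  pi1E_incl (pi1E_class injx a) = pi1E_class injx' (ep_incl a).
Proof.
apply/pi1E_classP; apply: homotopic_comp; first exact: conf_incl_continuous.
exact: pi1E_reprP.
Qed.
End ExtendedInclusion.
Arguments pi1E_incl R {X n} Gam {G} sGK sG {x} injx injx' u.

Section GeometricBraids.
Context {R : realType} {X : topologicalType} {n : nat} {Gam : simple_graph n}.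
Local Notation I := (unit_interval R).

(* The strand of a path f in X is the set {(f s, s)}, and the braid of a path a in
   F(X, Gam) is the set of the strands of its coordinates. *)
Definition strand (f : I -> X) : set (X * I) := range (fun s => (f s, s)).

Definition geom_braid (a : I -> conf X Gam) : set (set (X * I)) :=
  range (fun i => strand (fun s => coord (a s) i)).

Definition braid_homotopy (a b : I -> conf X Gam) : Prop :=
  exists h : 'I_n -> I * I -> X,
    [/\ forall i, continuous (fun p : I * I => (h i p, p.1)),
        forall i s, h i (s, zero) = coord (a s) i /\ h i (s, one) = coord (b s) i,
        forall i t, h i (zero, t) = coord (a zero) i /\
                    h i (zero, t) = coord (b zero) i,
        forall i t, h i (one, t) = coord (a one) i /\
                    h i (one, t) = coord (b one) i &
        forall j k p, Gam j k -> h j p <> h k p].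

Lemma braid_homotopyP (a b : I -> conf X Gam) :
  braid_homotopy a b <-> homotopic a b.
Proof.
split=> [[h [ch hs h0 h1 hne]]|[H [cH H0 H1 Hz Ho]]].
  exists (fun p => mk_conf (fun j k jk => hne j k p jk)).
  split=> [|s|s|t|t]; last 4 first.
  - by apply: conf_eqP => i; rewrite {1}/coord /= (hs i s).1.
  - by apply: conf_eqP => i; rewrite {1}/coord /= (hs i s).2.
  - by apply: conf_eqP => i; rewrite {1}/coord /= (h0 i t).1.
  - by apply: conf_eqP => i; rewrite {1}/coord /= (h1 i t).1.
  apply: conf_continuous => i; rewrite /coord /=.
  exact: (comp_cts (ch i) (@fst_cts _ _)).
exists (fun i p => coord (H p) i); split.
- move=> i; apply: pair_continuous; last exact: fst_cts.
  by apply: (@comp_cts _ _ _ H (fun y => coord y i)) => //; exact: coord_continuous.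
- by move=> i s; rewrite H0 H1.
- by move=> i t; rewrite -[b zero]H1 !Hz.
- by move=> i t; rewrite -[b one]H1 !Ho.
- by move=> j k p; exact: coord_neq.
Qed.

Lemma strand_inj (f g : I -> X) : strand f = strand g -> f = g.
Proof.
move=> fg; apply/funext => s.
have [s' _ [+ ss]] : strand g (f s, s) by rewrite -fg; exists s.
by rewrite ss.
Qed.

Lemma geom_braid_inj (a b : I -> conf X Gam) :
  a zero = b zero -> injective (coord (a zero)) ->
  geom_braid a = geom_braid b -> a = b.
Proof.
move=> ab0 inja ab; apply/funext => s; apply: conf_eqP => i.
have [j _ /strand_inj ij] : geom_braid b (strand (fun s => coord (a s) i)).
  by rewrite -ab; exists i.
have ji : j = i.
  by apply: inja; rewrite {1}ab0; exact: (congr1 (fun f => f zero) ij).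
by rewrite ji in ij; exact: (congr1 (fun f => f s) (esym ij)).
Qed.

End GeometricBraids.

Section BraidGroup.
Context {R : realType} {X : topologicalType} {n : nat} {Gam : simple_graph n}.
Context {x : conf X Gam} (injx : injective (coord x)).
Local Notation I := (unit_interval R).
Local Notation sA := (Aut_refl Gam).
Local Notation ext_path := (ext_path R sA x).
Implicit Types a b : ext_path.

Definition gbraid : Type := set_type (range (fun a : ext_path => geom_braid a)).

HB.instance Definition _ := Choice.on gbraid.

(* A braid determines its path (braid_of_inj), as the base point has pairwise
   distinct coordinates. *)
Definition braid_of a : gbraid := SigSub (mem_set (imageT (fun a : ext_path => geom_braid a) a)).

Definition braid_equiv (c d : gbraid) : Prop :=
  exists a b, [/\ c = braid_of a, d = braid_of b & braid_homotopy a b].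

Lemma braid_of_inj a b : braid_of a = braid_of b -> a = b :> (I -> conf X Gam).
Proof.
move=> /(congr1 val) /= /geom_braid_inj; apply; first by rewrite !ep_start.
by rewrite ep_start.
Qed.

Lemma braid_ofP (c : gbraid) : exists a, c = braid_of a.
Proof. by case: c => c cP; have [a _ ac] := set_mem cP; exists a; exact: val_inj. Qed.

Lemma braid_equivP a b : braid_equiv (braid_of a) (braid_of b) <-> homotopic a b.
Proof.
split=> [[a' [b' [/braid_of_inj -> /braid_of_inj -> /braid_homotopyP]]]//|ab].
by exists a, b; split => //; exact/braid_homotopyP.
Qed.

Let braid_equivb c d := `[< braid_equiv c d >].

Let braid_equiv_refl : reflexive braid_equivb.
Proof.
move=> c; apply/asboolP; have [a ->] := braid_ofP c.
exact/braid_equivP/homotopic_refl/ep_continuous.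
Qed.

Let braid_equiv_sym : symmetric braid_equivb.
Proof.
move=> c d; have [a ->] := braid_ofP c; have [b ->] := braid_ofP d.
by apply/asboolP/asboolP => /braid_equivP/homotopic_sym/braid_equivP.
Qed.

Let braid_equiv_trans : transitive braid_equivb.
Proof.
move=> d c e; have [a ->] := braid_ofP c; have [b ->] := braid_ofP d.
have [a' ->] := braid_ofP e => /asboolP/braid_equivP ab /asboolP/braid_equivP ba.
exact/asboolP/braid_equivP/(homotopic_trans ab).
Qed.

Definition braid_equiv_rel :=
  EquivRel _ braid_equiv_refl braid_equiv_sym braid_equiv_trans.

Definition braid_group : Type := {eq_quot braid_equiv_rel}.

HB.instance Definition _ := Choice.on braid_group.

Definition braid_class (c : gbraid) : braid_group :=
  \pi_({eq_quot braid_equiv_rel}) c.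

Lemma braid_classP a b :
  braid_class (braid_of a) = braid_class (braid_of b) <-> homotopic a b.
Proof.
rewrite -braid_equivP; split=> [/eqmodP/asboolP//|ab]; exact/eqmodP/asboolP.
Qed.

Lemma braid_class_surj (u : braid_group) : exists a, u = braid_class (braid_of a).
Proof.
have [a ac] := braid_ofP (repr (u : {eq_quot braid_equiv_rel})).
by exists a; rewrite -ac; apply/esym; exact: reprK.
Qed.

Definition braid_path (u : braid_group) : ext_path := projT1 (cid (braid_class_surj u)).

Lemma braid_pathK u : braid_class (braid_of (braid_path u)) = u.
Proof. by rewrite /braid_path; case: cid. Qed.

Lemma braid_pathP a : homotopic (braid_path (braid_class (braid_of a))) a.
Proof. by apply/braid_classP; rewrite braid_pathK. Qed.

Definition braid_mul (u v : braid_group) : braid_group :=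
  braid_class (braid_of (ep_cat (braid_path u) (braid_path v))).
Definition braid_inv (u : braid_group) : braid_group :=
  braid_class (braid_of (ep_rev (braid_path u))).
Definition braid_one : braid_group := braid_class (braid_of (ep_cst sA x)).

Let braid_ind (P : braid_group -> Prop) :
  (forall a, P (braid_class (braid_of a))) -> forall u, P u.
Proof. by move=> Pc u; rewrite -(braid_pathK u). Qed.

Lemma braid_mulE a b :
  braid_mul (braid_class (braid_of a)) (braid_class (braid_of b)) =
  braid_class (braid_of (ep_cat a b)).
Proof. by apply/braid_classP; apply: ep_cat_homotopic => //; exact: braid_pathP. Qed.

Lemma braid_invE a :
  braid_inv (braid_class (braid_of a)) = braid_class (braid_of (ep_rev a)).
Proof. by apply/braid_classP; apply: ep_rev_homotopic => //; exact: braid_pathP. Qed.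

Let braid_mulA : associative braid_mul.
Proof.
elim/braid_ind => a; elim/braid_ind => b; elim/braid_ind => c; rewrite !braid_mulE.
exact/braid_classP/ep_catA.
Qed.

Let braid_mul1g : left_id braid_one braid_mul.
Proof. by elim/braid_ind => a; rewrite braid_mulE; exact/braid_classP/ep_cst_cat. Qed.

Let braid_mulg1 : right_id braid_one braid_mul.
Proof. by elim/braid_ind => a; rewrite braid_mulE; exact/braid_classP/ep_cat_cst. Qed.

Let braid_mulgV : right_inverse braid_one braid_inv braid_mul.
Proof.
by elim/braid_ind => a; rewrite braid_invE braid_mulE; exact/braid_classP/ep_cat_rev.
Qed.

Let braid_mulVg : left_inverse braid_one braid_inv braid_mul.
Proof.
by elim/braid_ind => a; rewrite braid_invE braid_mulE; exact/braid_classP/ep_rev_cat.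
Qed.

HB.instance Definition _ := isGroup.Build braid_group
  braid_mulA braid_mul1g braid_mulg1 braid_mulVg braid_mulgV.

Definition braid_perm (u : braid_group) : [subg Aut Gam] := ep_perm (braid_path u).

Lemma braid_permE a : braid_perm (braid_class (braid_of a)) = ep_perm a.
Proof. by apply: ep_perm_homotopic => //; exact: braid_pathP. Qed.

Definition pure_braid : {pred braid_group} :=
  [pred u | `[< exists a, u = braid_class (braid_of a) /\ a one = x >]].

Lemma pure_braidP a :
  reflect (a one = x) (braid_class (braid_of a) \in pure_braid).
Proof.
apply: (iffP (asboolP _)) => [[b [/braid_classP/homotopic_end[_ ->]]]//|ax].
by exists a.
Qed.

Fact pure_braid_closed : group_closed pure_braid.
Proof.
split; first exact/pure_braidP.
move=> /=; elim/braid_ind => a; elim/braid_ind => b /pure_braidP ax /pure_braidP bx.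
have a1 : ep_perm a = 1%g by apply: ep_perm_eq => //; rewrite ax conf_act1.
have b1 : ep_perm b = 1%g by apply: ep_perm_eq => //; rewrite bx conf_act1.
rewrite [X in X \in _](_ : _ = braid_class (braid_of (ep_cat a (ep_rev b)))).
  apply/pure_braidP.
  by rewrite (@ep_permP R X n Gam) ep_perm_cat// ep_perm_rev// a1 b1 invg1 mulg1 conf_act1.
by rewrite -braid_mulE -braid_invE.
Qed.

Definition pure_braid_group : Type := {u : braid_group | u \in pure_braid}.

HB.instance Definition _ := SubChoice.on pure_braid_group.
HB.instance Definition _ :=
  SubChoice_isSubGroup.Build braid_group pure_braid pure_braid_group pure_braid_closed.

End BraidGroup.

Arguments braid_group R {X n Gam x} injx.
Arguments pure_braid {R X n Gam x} injx u.
Arguments pure_braid_group R {X n Gam x} injx.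
Arguments braid_perm R {X n Gam x} injx u.



(* By definition P(X, n) = pi_1(F(X, n), x) and B(X, n)|_Aut(Gam) =
   pi_1^E(F(X, n), x, Aut(Gam)(x)), and F(X, n) = F(X, K_n): these groups are
   pi1 R x and pi1E R (Aut_complete Gam) (coord_complete_inj x). *)
Section BraidInclusion.
Context {R : realType} {X : topologicalType} {n : nat} (Gam : simple_graph n).
Context (x : conf X (complete_graph n)).
Local Notation I := (unit_interval R).
Local Notation sAK := (Aut_complete Gam).
Local Notation sA := (Aut_refl Gam).

Lemma coord_incl_inj : injective (coord (conf_incl Gam x)).
Proof. exact: coord_complete_inj. Qed.

Definition braid_incl (u : pi1E R sAK (coord_complete_inj x)) :
    braid_group R coord_incl_inj :=
  braid_class coord_incl_inj (braid_of (ep_incl sA (pi1E_repr u))).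

Lemma braid_inclE (a : ext_path R sAK x) :
  braid_incl (pi1E_class (coord_complete_inj x) a) =
  braid_class coord_incl_inj (braid_of (ep_incl sA a)).
Proof.
apply/braid_classP; apply: homotopic_comp; first exact: conf_incl_continuous.
exact: pi1E_reprP.
Qed.

Definition loop_incl (a : {path I from x to x}) :
    ext_path R sA (conf_incl Gam x) :=
  ep_of_loop sA
    ((conf_incl Gam \o a) : {path I from conf_incl Gam x to conf_incl Gam x}).

Lemma loop_incl_pure (a : {path I from x to x}) :
  braid_class coord_incl_inj (braid_of (loop_incl a))
    \in pure_braid coord_incl_inj.
Proof. by apply/pure_braidP; rewrite /= path_one. Qed.

Definition pure_braid_incl (u : pi1 R x) : pure_braid_group R coord_incl_inj :=
  SigSub (loop_incl_pure (pi1_repr u)).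

Lemma pure_braid_inclE (a : {path I from x to x}) :
  val (pure_braid_incl (pi1_class a)) =
  braid_class coord_incl_inj (braid_of (loop_incl a)).
Proof.
apply/braid_classP; apply: homotopic_comp; first exact: conf_incl_continuous.
exact: pi1_reprP.
Qed.

End BraidInclusion.
Arguments coord_incl_inj {X n} Gam x [_ _] _.
Arguments braid_incl R {X n} Gam x u.
Arguments pure_braid_incl R {X n} Gam x u.

(* Exactness of 1 -> A -> B -> C -> 1, for group morphisms f and g. *)
Definition short_exact (A B C : groupType) (f : A -> B) (g : B -> C) : Prop :=
  [/\ {morph f : a a' / (a * a')%g}, {morph g : b b' / (b * b')%g},
      injective f, range f = [set b | g b = 1%g] & range g = setT].

Definition ses_epimorphism (A B C A' B' C' : groupType)
    (f : A -> B) (g : B -> C) (f' : A' -> B') (g' : B' -> C')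
    (u : A -> A') (v : B -> B') (w : C -> C') : Prop :=
  [/\ short_exact f g /\ short_exact f' g',
      [/\ {morph u : a a' / (a * a')%g}, {morph v : b b' / (b * b')%g} &
          {morph w : c c' / (c * c')%g}],
      v \o f = f' \o u, w \o g = g' \o v &
      [/\ range u = setT, range v = setT & range w = setT]].

(* Main.v *)
From mathcomp Require Import all_boot all_order all_algebra all_fingroup.
From mathcomp Require Import all_classical all_reals topology normedtype homotopy.
From mathcomp Require Import ring lra.
Require Import Defs.
Set Implicit Arguments.
Unset Strict Implicit.
Unset Printing Implicit Defensive.
Import Order.TTheory GRing.Theory Num.Theory numFieldNormedType.Exports.
Local Open Scope classical_set_scope.
Local Open Scope ring_scope.

(** The algebra is formal; the surjectivity of the vertical maps and of the maps
    to [Aut Gam] comes down to the fact that a path of [F(X, Gam)] whose ends lie in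
    [F(X, n)] is homotopic, relative to its ends, to a path inside [F(X, n)]
    ([path_deformable]).  The reason is that [F(X, n)] is obtained from
    [F(X, Gam)] by removing pieces of codimension at least two; since no
    transversality is available on a topological manifold, the proof is by a
    direct local argument.

    Every point of [F(X, Gam)] has a basis of neighbourhoods that are boxes, i.e.
    products of chart balls ([cell]) which are disjoint for adjacent vertices
    ([box_base]).  A box is contained in [F(X, Gam)], and two paths in it with the
    same ends are homotopic ([box_homotopic]).  The part of [F(X, n)] inside a box
    is path connected ([box_connected]): a ball of dimension at least two minus
    finitely many points is path connected, so the points can be moved one at a
    time while avoiding the others, first to generic places and then to their
    destinations.  Moving one point at a time never requires comparing two
    charts.  Hence a path inside a box with ends in [F(X, n)] is deformable, and a
    path [f] that crosses several boxes is treated by a continuity argument in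
    [t]: the initial part of [f] up to [t], completed by a short path to
    [F(X, n)], is deformable for [t = 0], and this property is locally constant
    in [t].

    With the graph without edges, for which the configuration space is the whole
    power of [X], the same theorem shows that [F(X, n)] is path connected
    ([complete_conf_path_connected]), whence the surjectivity of the maps to
    [Aut Gam]; with the given graph it gives the surjectivity of the vertical
    maps. *)

(** * Charts onto balls *)

Section Charts.
Context {R : realType} {X : topologicalType} {m : nat}.

(** A homeomorphism of the open set [U] with the ball of centre [c] and radius
    [r], and its inverse, as total functions [h] and [e] that matter only on [U]
    and on the ball.  Their continuity is expressed on maps landing in [U], resp.
    in the ball, so that no subspace appears. *)
Record ball_chart (U : set X) (c : 'rV[R]_m) (r : R)
    (e : 'rV[R]_m -> X) (h : X -> 'rV[R]_m) : Prop := BallChart {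
  bc_open : open U;
  bc_h : forall x, U x -> ball c r (h x) /\ e (h x) = x;
  bc_e : forall v, ball c r v -> U (e v) /\ h (e v) = v;
  bc_h_cts : forall (T : topologicalType) (a : T -> X),
    continuous a -> (forall t, U (a t)) -> continuous (h \o a);
  bc_e_cts : forall (T : topologicalType) (a : T -> 'rV[R]_m),
    continuous a -> (forall t, ball c r (a t)) -> continuous (e \o a)
}.

(** An open subset of an open subspace is open in the ambient space. *)
Lemma open_set_typeP (T : topologicalType) (A : set T) (B : set A) :
  open A -> open B -> open [set x | exists2 u : A, val u = x & B u].
Proof.
move=> oA [C oC CB].
rewrite (_ : mkset _ = A `&` C); first exact: openI.
apply/seteqP; split=> [_ [u <- Bu]|x [Ax Cx]].
  by split; [exact: set_valP|move: Bu; rewrite -CB].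
by exists (SigSub (mem_set Ax)) => //; rewrite -CB.
Qed.

Lemma manifold_ball_chart (p : X) (O : set X) :
  topological_manifold R m X -> open O -> O p ->
  exists U c r e h, [/\ U p, U `<=` O & ball_chart U c r e h].
Proof.
move=> [_ _ /(_ p)[U0 [V0 [oU Up oV [f [g [cf cg fK gK]]]]]]] oO Op.
(* 0 and p are junk values outside of the chart *)
pose h x : 'rV[R]_m := if pselect (U0 x) is left H then val (f (SigSub (mem_set H))) else 0.
pose e v : X := if pselect (V0 v) is left H then val (g (SigSub (mem_set H))) else p.
have hE (u : U0) : h (val u) = val (f u).
  rewrite /h; case: pselect => [H|]; last by have := set_valP u.
  by congr (val (f _)); exact: val_inj.
have eE (u : V0) : e (val u) = val (g u).
  rewrite /e; case: pselect => [H|]; last by have := set_valP u.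
  by congr (val (g _)); exact: val_inj.
have sigU x : U0 x -> exists u : U0, val u = x by move=> H; exists (SigSub (mem_set H)).
have [p' pE] := sigU _ Up.
(* the ball is taken inside the preimage of O, so that U is contained in O *)
have oO' : open [set v | exists2 u : V0, val u = v & O (val (g u))].
  apply: (@open_set_typeP _ _ [set u : V0 | O (val (g u))]) => //.
  rewrite -[mkset _]/((fun u => val (g u)) @^-1` O).
  by apply: open_comp => // u _; apply: (@comp_cts _ _ _ g val) => //; exact: initial_continuous.
have /nbhs_ballP[r r0 rO] : nbhs (h p) [set v | exists2 u : V0, val u = v & O (val (g u))].
  apply: open_nbhs_nbhs; split=> //; exists (f p'); first by rewrite -pE hE.
  by rewrite fK pE.
exists [set x | exists2 u : U0, val u = x & ball (h p) r (val (f u))], (h p), r, e, h.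
have hK (u : U0) : e (h (val u)) = val u by rewrite hE eE fK.
have eK (u : V0) : h (e (val u)) = val u by rewrite eE hE gK.
split.
- by exists p' => //; rewrite -hE pE; exact: ballxx.
- by move=> _ [u <-] /rO[v /val_inj ->]; rewrite fK.
split.
- apply: (@open_set_typeP _ _ [set u : U0 | ball (h p) r (val (f u))]) => //.
  rewrite -[mkset _]/((fun u => val (f u)) @^-1` (ball (h p) r)).
  apply: open_comp; last exact: ball_open.
  by move=> u _; apply: (@comp_cts _ _ _ f val) => //; exact: initial_continuous.
- by move=> _ [u <- Du]; rewrite hK hE.
- move=> v Dv; have [w wv _] := rO _ Dv; rewrite -wv eK; split=> //.
  by exists (g w); [rewrite eE|rewrite gK wv].
- move=> T a ca aU; have aU0 t : U0 (a t) by have [u <- _] := aU t; exact: set_valP.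
  pose b t : U0 := SigSub (mem_set (aU0 t)).
  have cb : continuous b by apply: continuous_comp_initial.
  rewrite (_ : _ \o _ = (fun t => val (f (b t)))); last first.
    by apply/funext => t /=; rewrite -hE.
  apply: (@comp_cts _ _ _ b (fun u => val (f u))) => //.
  by apply: (@comp_cts _ _ _ f val) => //; exact: initial_continuous.
- move=> T a ca aV; have aV0 t : V0 (a t) by have [u <- _] := rO _ (aV t); exact: set_valP.
  pose b t : V0 := SigSub (mem_set (aV0 t)).
  have cb : continuous b by apply: continuous_comp_initial.
  rewrite (_ : _ \o _ = (fun t => val (g (b t)))); last first.
    by apply/funext => t /=; rewrite -eE.
  apply: (@comp_cts _ _ _ b (fun u => val (g u))) => //.
  by apply: (@comp_cts _ _ _ g val) => //; exact: initial_continuous.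
Qed.

End Charts.

(** * General position in a ball *)

Section GenericParameter.
Context {R : realFieldType} {T : eqType}.

(** If each member of a finite family excludes at most one parameter, then there
    are arbitrarily small positive parameters that no member excludes. *)
Lemma generic_parameter (bad : R -> T -> Prop) (F : seq T) (eps : R) :
  0 < eps ->
  (forall y t u, y \in F -> bad t y -> bad u y -> t = u) ->
  exists2 t, 0 < t < eps & forall y, y \in F -> ~ bad t y.
Proof.
move=> eps0 badF.
have [d /andP[d0 de] dF] : exists2 d, 0 < d <= eps &
    forall y t, y \in F -> 0 < t < d -> ~ bad t y.
  elim: F badF => [_|y F IH badF]; first by exists eps; rewrite ?eps0 ?lexx.
  have [|d /andP[d0 de] dF] := IH.
    by move=> z t u zF; apply: badF; rewrite inE zF orbT.
  have [[t /andP[t0 td] bt]|nb] := pselect (exists2 t, 0 < t < d & bad t y).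
    exists t; first by rewrite t0 (le_trans (ltW td)).
    move=> z u; rewrite inE => /predU1P[-> /andP[_ ut] bu|zF /andP[u0 ut]].
      by rewrite (badF y u t) ?mem_head ?ltxx// in ut.
    by apply: dF => //; rewrite u0 (lt_trans ut).
  exists d; first by rewrite d0.
  move=> z u; rewrite inE => /predU1P[-> ud bu|]; last exact: dF.
  by apply: nb; exists u.
exists (d / 2); first by rewrite divr_gt0//= ltr_pdivrMr//; lra.
by move=> y yF; apply: dF => //; rewrite divr_gt0//= ltr_pdivrMr//; lra.
Qed.

End GenericParameter.

Section BallCurves.
Context {R : realType} {m : nat}.
Implicit Types p q w c : 'rV[R]_m.

(** The arc from [p] to [q], parametrized by [s], obtained from the segment by
    bending it in the direction [w] with amplitude [t]. *)
Definition bent (p q w : 'rV[R]_m) (t s : R) : 'rV[R]_m :=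
  p + s *: (q - p) + (t * (s * (1 - s))) *: w.

Lemma bent0 p q w t : bent p q w t 0 = p.
Proof. by apply/rowP => i; rewrite !mxE; ring. Qed.

Lemma bent1 p q w t : bent p q w t 1 = q.
Proof. by apply/rowP => i; rewrite !mxE; ring. Qed.

(** A slightly bent arc between two points of a ball stays in the ball. *)
Lemma ball_bent p q w c r : ball c r p -> ball c r q ->
  exists2 eps, 0 < eps & forall t s, 0 <= t < eps -> 0 <= s <= 1 ->
    ball c r (bent p q w t s).
Proof.
rewrite -ball_normE /ball_ /= => cp cq.
pose d := Num.max `|c - p| `|c - q|.
have dr : d < r by rewrite /d gt_max cp cq.
have [dp dq] : `|c - p| <= d /\ `|c - q| <= d by rewrite /d !le_max !lexx orbT.
(* the segment stays at distance at most d from c, and bending moves its points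
   by at most t * `|w|, as s * (1 - s) is at most 1 *)
exists ((r - d) / (`|w| + 1)) => [|t s /andP[t0 te] /andP[s0 s1]].
  by rewrite divr_gt0 ?subr_gt0// ltr_wpDl.
have -> : c - bent p q w t s =
    (1 - s) *: (c - p) + s *: (c - q) - (t * (s * (1 - s))) *: w.
  by apply/rowP => i; rewrite !mxE; ring.
apply: (le_lt_trans (ler_normB _ _)).
apply: (@le_lt_trans _ _ (`|(1 - s) *: (c - p)| + `|s *: (c - q)| + t * `|w|)).
  apply: lerD; first exact: ler_normD.
  rewrite normrZ ler_wpM2r// ger0_norm ?mulr_ge0 ?subr_ge0// ler_piMr//.
  by rewrite -[leRHS](mulr1 1) ler_pM ?subr_ge0// gerBl.
rewrite !normrZ !ger0_norm ?subr_ge0//.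
move: te; rewrite ltr_pdivlMr; last by rewrite ltr_wpDl.
move=> te; apply: (@le_lt_trans _ _ ((1 - s) * d + s * d + t * `|w|)).
  by rewrite lerD2r lerD// ler_wpM2l ?subr_ge0.
have := normr_ge0 w; nra.
Qed.

Lemma bent_continuous (T : topologicalType) (a b : T -> 'rV[R]_m) w t (u : T -> R) :
  continuous a -> continuous b -> continuous u ->
  continuous (fun x => bent (a x) (b x) w t (u x)).
Proof.
move=> ca cb cu x; apply: cvgD.
  by apply: cvgD; [exact: ca|apply: cvgZ; [exact: cu|apply: cvgB; [exact: cb|exact: ca]]].
apply: cvgZ; last exact: cvg_cst.
apply: cvgM; first exact: cvg_cst.
by apply: cvgM; [exact: cu|apply: cvgB; [exact: cvg_cst|exact: cu]].
Qed.

(** Two arcs from [p] to [q] bent by different amounts along the [j]-th axis meet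
    only at their ends, if [p] and [q] differ in another coordinate [i]: the
    [i]-th coordinate of a point of the arc determines [s], and then the [j]-th
    one determines [t].  This is where dimension at least two is needed. *)
Lemma bent_inj p q (i j : 'I_m) t t' s s' : i != j -> p 0 i != q 0 i ->
  0 < s < 1 ->
  bent p q (delta_mx 0 j) t s = bent p q (delta_mx 0 j) t' s' -> t = t'.
Proof.
move=> ij pqi /andP[s0 s1] e.
have := congr1 (fun v : 'rV_m => v 0 i) e.
rewrite !mxE /= (negbTE ij) !mulr0 !addr0 => /addrI.
move=> /(mulIf _) ss; rewrite -ss in e; last by rewrite subr_eq0 eq_sym.
have := congr1 (fun v : 'rV_m => v 0 j) e.
rewrite !mxE /= eqxx !mulr1 => /addrI/(mulIf _); apply.
by rewrite mulf_neq0 ?gt_eqF// subr_gt0.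
Qed.

(** The complement of a finite set in a ball is path connected. *)
Lemma ball_avoid p q c r (F : seq 'rV[R]_m) : (1 < m)%N ->
  ball c r p -> ball c r q -> p \notin F -> q \notin F ->
  exists w t, forall s, 0 <= s <= 1 ->
    ball c r (bent p q w t s) /\ bent p q w t s \notin F.
Proof.
move=> m1 cp cq pF qF.
have [pq|] := eqVneq p q.
  exists 0, 0 => s s01; have -> : bent p q 0 0 s = p.
    by rewrite pq; apply/rowP => i; rewrite !mxE; ring.
  by split.
move=> pq; have /existsNP[i /eqP pqi] : ~ (forall i, p 0 i = q 0 i).
  by move=> /rowP/eqP; exact/negP.
have [j ij] : exists j, i != j.
  have : (0 < #|predC1 i|)%N by rewrite cardC1 card_ord -ltnS prednK// ltnW.
  by case/card_gt0P => j; rewrite inE eq_sym => ij; exists j.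
have [eps eps0 be] := ball_bent (delta_mx 0 j) cp cq.
have [|t /andP[t0 te] tF] := @generic_parameter _ _
   (fun t y => exists2 s, 0 < s < 1 & bent p q (delta_mx 0 j) t s = y) F eps eps0.
  by move=> y t u _ [s s01 <-] [s' _] /esym; exact: (bent_inj ij pqi s01).
exists (delta_mx 0 j), t => s /andP[s0 s1]; split.
  by apply: be; rewrite ?s0// (ltW t0).
move: s0; rewrite le_eqVlt => /predU1P[<-|s0]; first by rewrite bent0.
move: s1; rewrite le_eqVlt => /predU1P[->|s1]; first by rewrite bent1.
by apply/negP => /tF; apply; exists s; rewrite ?s0.
Qed.

Lemma ball_not_finite c r (F : seq 'rV[R]_m) : (0 < m)%N -> 0 < r ->
  exists2 p, ball c r p & p \notin F.
Proof.
move=> m0 r0; pose j := Ordinal m0.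
pose pt t : 'rV[R]_m := bent c c (delta_mx 0 j) t 2^-1.
have [eps eps0 be] := ball_bent (delta_mx 0 j) (ballxx c r0) (ballxx c r0).
have [|t /andP[t0 te] tF] := @generic_parameter _ _ (fun t y => pt t = y) F eps eps0.
  move=> y t u _ <- /(congr1 (fun v : 'rV_m => v 0 j)).
  by rewrite !mxE !eqxx /=; lra.
exists (pt t); last by apply/negP => /tF; exact.
by apply: be; [rewrite ltW|lra].
Qed.

End BallCurves.

(** * Cells *)

Section Cells.
Context {R : realType} {X : topologicalType}.
Local Notation I := (unit_interval R).

(** What the argument retains of an open ball of dimension at least two, embedded
    in [X]: paths with the same ends are homotopic inside, the complement of any
    finite set is path connected, and the set is infinite. *)
Record cell (V : set X) : Prop := Cell {
  cell_open : open V;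
  cell_homotopic : forall f g : I -> X, continuous f -> continuous g ->
    (forall s, V (f s)) -> (forall s, V (g s)) ->
    f zero = g zero -> f one = g one ->
    exists H : I * I -> X,
      [/\ continuous H, forall p, V (H p),
          (forall s, H (s, zero) = f s) /\ (forall s, H (s, one) = g s),
          forall t, H (zero, t) = f zero &
          forall t, H (one, t) = f one];
  cell_avoid : forall (F : seq X) p q,
    V p -> V q -> p \notin F -> q \notin F ->
    exists f : I -> X, [/\ continuous f, f zero = p, f one = q &
      forall s, V (f s) /\ f s \notin F];
  cell_infinite : forall F : seq X, exists2 p, V p & p \notin F
}.

Lemma ball_chart_cell m U (c : 'rV[R]_m) r e h : (1 < m)%N -> U !=set0 ->
  @ball_chart R X m U c r e h -> cell U.
Proof.
move=> m1 [x0 Ux0] [oU hU eU ch ce].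
have r0 : 0 < r by have [+ _] := hU _ Ux0; rewrite -ball_normE /= => /(le_lt_trans _); apply.
split=> //.
- move=> f g cf cg Uf Ug fg0 fg1.
  (* the straight-line homotopy in the chart *)
  pose k (p : I * I) := bent (h (f p.1)) (h (g p.1)) 0 0 (ui_val p.2).
  have kU p : ball c r (k p).
    have [eps eps0 be] := ball_bent 0 (hU _ (Uf p.1)).1 (hU _ (Ug p.1)).1.
    by apply: be; [rewrite lexx|exact: ui_valP].
  have ck : continuous k.
    apply: bent_continuous.
    + by apply: (@comp_cts _ _ _ fst (h \o f)); [exact: fst_cts|exact: ch].
    + by apply: (@comp_cts _ _ _ fst (h \o g)); [exact: fst_cts|exact: ch].
    + by apply: comp_cts; [exact: snd_cts|exact: ui_val_continuous].
  have bb (v : 'rV[R]_m) s : bent v v 0 0 s = v.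
    by apply/rowP => i; rewrite !mxE; ring.
  exists (e \o k); split; first exact: ce.
  + by move=> p; have [] := eU _ (kU p).
  + split=> s; rewrite /k /=; first by rewrite ui_val0 bent0 (hU _ (Uf s)).2.
    by rewrite ui_val1 bent1 (hU _ (Ug s)).2.
  + by move=> t; rewrite /k /= -fg0 bb (hU _ (Uf zero)).2.
  + by move=> t; rewrite /k /= -fg1 bb (hU _ (Uf one)).2.
- move=> F p q Up Uq pF qF.
  have memF y : U y -> y \notin F -> h y \notin [seq h z | z <- F & `[< U z >]].
    move=> Uy; apply: contra => /mapP[z]; rewrite mem_filter => /andP[/asboolP Uz zF].
    by move=> /(congr1 e); rewrite (hU _ Uy).2 (hU _ Uz).2 => ->.
  (* only the points of F lying in U are visible in the chart *)
  have [w [t wt]] := ball_avoid m1 (hU _ Up).1 (hU _ Uq).1 (memF _ Up pF) (memF _ Uq qF).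
  pose k (s : I) := bent (h p) (h q) w t (ui_val s).
  have kU s : ball c r (k s) by have [] := wt _ (ui_valP s).
  exists (e \o k); split.
  + by apply: ce => //; apply: bent_continuous; [exact: cst_cts..|exact: ui_val_continuous].
  + by rewrite /k /= ui_val0 bent0 (hU _ Up).2.
  + by rewrite /k /= ui_val1 bent1 (hU _ Uq).2.
  + move=> s; have [Uk hk] := eU _ (kU s); split=> //.
    have [_] := wt _ (ui_valP s); apply: contra => kF.
    by apply/mapP; exists (e (k s)); rewrite ?hk// mem_filter kF andbT; exact/asboolP.
- move=> F; have [p cp pF] := ball_not_finite c [seq h z | z <- F & `[< U z >]] (ltnW m1) r0.
  have [Up hp] := eU _ cp; exists (e p) => //; apply: contra pF => epF.
  by apply/mapP; exists (e p); rewrite ?hp// mem_filter epF andbT; exact/asboolP.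
Qed.

(** The cells form a basis of the topology of [X]. *)
Definition cell_basis : Prop := forall (p : X) (O : set X), open O -> O p ->
  exists U, [/\ cell U, U p & U `<=` O].

Lemma manifold_cell_basis m : (1 < m)%N -> topological_manifold R m X -> cell_basis.
Proof.
move=> m1 mX p O oO Op; have [U [c [r [e [h [Up UO bU]]]]]] := manifold_ball_chart mX oO Op.
by exists U; split=> //; apply: ball_chart_cell bU => //; exists p.
Qed.

End Cells.
Arguments cell_basis R X : clear implicits.

(** * Boxes in configuration spaces *)

Section Boxes.
Context {R : realType} {X : topologicalType} {n : nat}.
Local Notation I := (unit_interval R).
Local Notation K := (complete_graph n).
Implicit Types (W : 'I_n -> set X) (Gam : simple_graph n).

(** The product of the cells [W i] is contained in [F(X, Gam)], as cells with
    adjacent indices are disjoint; other cells may overlap in any way. *)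
Record box Gam W : Prop := Box {
  box_cell : forall i, cell (R := R) (W i);
  box_disjoint : forall j k p, Gam j k -> W j p -> ~ W k p
}.

Definition in_box Gam W (c : conf X Gam) : Prop := forall i, W i (coord c i).

Lemma box_homotopic Gam W (f g : I -> conf X Gam) : box Gam W ->
  continuous f -> continuous g ->
  (forall s, in_box W (f s)) -> (forall s, in_box W (g s)) ->
  f zero = g zero -> f one = g one -> homotopic f g.
Proof.
move=> [cW dW] cf cg Wf Wg fg0 fg1.
have cc (f' : I -> conf X Gam) i : continuous f' -> continuous (fun s => coord (f' s) i).
  by move=> cf'; apply: (@comp_cts _ _ _ f' (fun y => coord y i)) => //; exact: coord_continuous.
have /choice[H HP] i := cell_homotopic (cW i) (cc f i cf) (cc g i cg)
  (fun s => Wf s i) (fun s => Wg s i) (congr1 (fun y => coord y i) fg0)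
  (congr1 (fun y => coord y i) fg1).
have Hne p j k : Gam j k -> H j p <> H k p.
  move=> jk Hjk; have [_ + _ _ _] := HP j => /(_ p) /(dW _ _ _ jk); apply.
  by rewrite Hjk; have [_ + _ _ _] := HP k; exact.
exists (fun p => mk_conf (Hne p)); split.
- by apply: conf_continuous => i; have [] := HP i.
- by move=> s; apply: conf_eqP => i; have [_ _ [H0 _] _ _] := HP i; exact: H0.
- by move=> s; apply: conf_eqP => i; have [_ _ [_ H1] _ _] := HP i; exact: H1.
- by move=> t; apply: conf_eqP => i; have [_ _ _ Hz _] := HP i; exact: Hz.
- by move=> t; apply: conf_eqP => i; have [_ _ _ _ Ho] := HP i; exact: Ho.
Qed.

Lemma generic_points W (F : seq X) : (forall i, cell (R := R) (W i)) ->
  exists w : 'I_n -> X, [/\ injective w, forall i, W i (w i) & forall i, w i \notin F].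
Proof.
move=> cW.
suff [w winj wW] : exists2 w : 'I_n -> X, {in enum 'I_n &, injective w} &
    {in enum 'I_n, forall i, W i (w i) /\ w i \notin F}.
  exists w; split=> [i j|i|i]; first by apply: winj; rewrite mem_enum.
    by have [] := wW i (mem_enum _ _).
  by have [] := wW i (mem_enum _ _).
elim: (enum 'I_n) => [|i s [w winj wW]].
  have /choice[w _] : forall i, exists p, W i p.
    by move=> i; have [p] := cell_infinite (cW i) [::]; exists p.
  by exists w.
have [z Wz zF] := cell_infinite (cW i) (F ++ map w s).
move: zF; rewrite mem_cat negb_or => /andP[zF zw].
have [si|si] := boolP (i \in s).
  have ss j : (j \in i :: s) = (j \in s) by rewrite inE; case: eqP => // ->.
  exists w => [j k|j]; rewrite !ss; [exact: winj|exact: wW].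
(* w already chosen on s is kept, and i gets the new point z *)
have ne j : j \in s -> j == i = false by move=> js; apply/eqP => ji; rewrite -ji js in si.
exists (fun j => if j == i then z else w j) => [j k|j]; rewrite !inE.
  case/predU1P => [->|js]; case/predU1P => [->|ks]; rewrite ?eqxx ?(ne _ js) ?(ne _ ks) //.
  - by move=> zk; rewrite zk map_f in zw.
  - by move=> zk; rewrite -zk map_f in zw.
  - exact: winj.
by case/predU1P => [->|js]; [rewrite eqxx|rewrite ne//; exact: wW].
Qed.

(** There is a path from [y] to [z] in the part of [F(X, n)] inside [W]. *)
Definition box_joined W (y z : conf X K) : Prop :=
  exists b : I -> conf X K, [/\ continuous b, b zero = y, b one = z &
    forall s, in_box W (b s)].

Lemma box_joined_sym W y z : box_joined W y z -> box_joined W z y.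
Proof.
move=> [b [cb b0 b1 Wb]]; exists (path_rev b); split.
- exact: path_rev_continuous.
- by rewrite path_rev0.
- by rewrite path_rev1.
- by move=> s; exact: Wb.
Qed.

Lemma box_joined_trans W x y z :
  box_joined W x y -> box_joined W y z -> box_joined W x z.
Proof.
move=> [a [ca a0 a1 Wa]] [b [cb b0 b1 Wb]]; exists (path_cat a b); split.
- by apply: path_cat_continuous; rewrite ?a1.
- by rewrite path_cat0.
- by rewrite path_cat1.
- by move=> s; rewrite /path_cat; case: ifP.
Qed.

Lemma box_joined_move W (y z : conf X K) i : (forall i, cell (R := R) (W i)) ->
  in_box W y -> in_box W z -> (forall j, j != i -> coord z j = coord y j) ->
  box_joined W y z.
Proof.
move=> cW Wy Wz yz.
pose F := [seq coord y j | j <- enum 'I_n & j != i].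
have inF j : j != i -> coord y j \in F.
  by move=> ji; rewrite map_f// mem_filter ji mem_enum.
have notF (y' : conf X K) : (forall j, j != i -> coord y' j = coord y j) -> coord y' i \notin F.
  move=> yy; apply/mapP => -[j]; rewrite mem_filter => /andP[ji _].
  by rewrite -yy// => /(@coord_complete_inj _ _ y')/esym/eqP; exact/negP.
have [f [cf f0 f1 Wf]] := cell_avoid (cW i) (Wy i) (Wz i) (notF y (fun _ _ => erefl)) (notF z yz).
have bne s j k : K j k ->
    (if j == i then f s else coord y j) <> (if k == i then f s else coord y k).
  have fF l : l != i -> f s <> coord y l.
    by move=> /inF lF fl; have [_] := Wf s; rewrite fl lF.
  move=> /= jk; case: eqP => [ji|/eqP ji]; case: eqP => [ki|/eqP ki].
  - by rewrite ji ki eqxx in jk.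
  - exact: fF.
  - by move/esym; exact: fF.
  - by move=> /(@coord_complete_inj _ _ y)/eqP; exact/negP.
exists (fun s => mk_conf (@bne s)); split.
- apply: conf_continuous => j; rewrite /coord /=.
  by case: eqP => // _; exact: cst_cts.
- by apply: conf_eqP => j; rewrite {1}/coord /=; case: eqP => // ->.
- apply: conf_eqP => j; rewrite {1}/coord /=.
  by case: eqP => [->//|/eqP ji]; rewrite yz.
- move=> s j; rewrite /coord /=.
  by case: eqP => [->|_]; [have [] := Wf s|exact: Wy].
Qed.

(** When no point of [w] is a point of [y], the points of [y] can be moved to
    those of [w] one after the other: all the intermediate configurations mix
    points of [y] with points of [w], hence are injective. *)
Lemma box_joined_disjoint W (y w : conf X K) : (forall i, cell (R := R) (W i)) ->
  in_box W y -> in_box W w -> (forall i j, coord y i <> coord w j) ->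
  box_joined W y w.
Proof.
move=> cW Wy Ww yw.
suff [z yz zE] : exists2 z : conf X K, box_joined W y z &
    forall i, coord z i = if i \in enum 'I_n then coord w i else coord y i.
  by have -> : w = z by apply: conf_eqP => i; rewrite zE mem_enum.
elim: (enum 'I_n) => [|i s [z yz zE]].
  by exists y => //; exists (cst y); split=> //; exact: cst_cts.
have ne j k : K j k -> (if j \in i :: s then coord w j else coord y j) <>
    (if k \in i :: s then coord w k else coord y k).
  move=> /= jk; case: ifP => _; case: ifP => _.
  - by move=> /(@coord_complete_inj _ _ w)/eqP; exact/negP.
  - by move=> /esym; exact: yw.
  - exact: yw.
  - by move=> /(@coord_complete_inj _ _ y)/eqP; exact/negP.
exists (mk_conf ne) => //; apply: box_joined_trans yz _.
apply: (@box_joined_move _ _ _ i) => //.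
- by move=> j; rewrite zE; case: ifP.
- by move=> j; rewrite /coord /=; case: ifP => _; [exact: Ww|exact: Wy].
- by move=> j ji; rewrite zE {1}/coord /= inE (negbTE ji).
Qed.

(** The passage through a configuration disjoint from both ends makes the
    previous lemma applicable. *)
Lemma box_connected W (y z : conf X K) : (forall i, cell (R := R) (W i)) ->
  in_box W y -> in_box W z -> box_joined W y z.
Proof.
move=> cW Wy Wz.
have [w [winj Ww wF]] := generic_points (codom (coord y) ++ codom (coord z)) cW.
have wK j k : K j k -> w j <> w k by move=> /= jk /winj/eqP; exact/negP.
have yzw (y' : conf X K) : {subset codom (coord y') <= codom (coord y) ++ codom (coord z)} ->
    forall i j, coord y' i <> coord (mk_conf wK) j.
  by move=> sub i j e; have /negP := wF j; apply; apply: sub; rewrite -[w j]e codom_f.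
apply: (@box_joined_trans _ _ (mk_conf wK)).
  by apply: box_joined_disjoint => //; apply: yzw => p; rewrite mem_cat => ->.
apply: box_joined_sym.
by apply: box_joined_disjoint => //; apply: yzw => p; rewrite mem_cat => ->; rewrite orbT.
Qed.

(** Every configuration in a box can be moved, inside the box, to one with
    pairwise distinct points. *)
Lemma box_approx Gam W (c : conf X Gam) : box Gam W -> in_box W c ->
  exists (y : conf X K) (g : I -> conf X Gam),
    [/\ continuous g, g zero = c, g one = conf_incl Gam y & forall s, in_box W (g s)].
Proof.
move=> [cW dW] Wc; have [y [yinj Wy _]] := generic_points [::] cW.
have yK j k : K j k -> y j <> y k by move=> /= jk /yinj/eqP; exact/negP.
have /choice[g gP] i := cell_avoid (cW i) (Wc i) (Wy i) (F := [::]) isT isT.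
have gne s j k : Gam j k -> g j s <> g k s.
  move=> jk e; have [_ _ _ /(_ s)[/(dW _ _ _ jk) + _]] := gP j.
  by rewrite e; apply; have [_ _ _ /(_ s)[]] := gP k.
exists (mk_conf yK), (fun s => mk_conf (@gne s)); split.
- by apply: conf_continuous => i; have [] := gP i.
- by apply: conf_eqP => i; have [] := gP i.
- by apply: conf_eqP => i; have [] := gP i.
- by move=> s i; have [_ _ _ /(_ s)[]] := gP i.
Qed.

Context (hausX : hausdorff_space X).
Context (baseX : cell_basis R X).

(** The boxes form a basis of the topology of [F(X, Gam)]; the disjointness of
    adjacent cells comes from [X] being Hausdorff. *)
Lemma box_base Gam (c : conf X Gam) (O : 'I_n -> set X) :
  (forall i, open (O i)) -> (forall i, O i (coord c i)) ->
  exists W, [/\ box Gam W, in_box W c & forall i, W i `<=` O i].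
Proof.
move=> oO Oc.
have sep j : forall k, exists AB : set X * set X,
    [/\ nbhs (coord c j) AB.1, nbhs (coord c k) AB.2 &
        Gam j k -> forall p, AB.1 p -> ~ AB.2 p].
  move=> k; have [jk|njk] := boolP (Gam j k); last first.
    by exists (setT, setT); split=> //; exact: filterT.
  have /eqP cjk := coord_neq (x := c) jk.
  move: hausX; rewrite open_hausdorff => /(_ _ _ cjk).
  move=> [[A B] /= [/set_mem Aj /set_mem Bk] [oA oB /eqP AB0]].
  exists (A, B); split=> /=; [exact: open_nbhs_nbhs|exact: open_nbhs_nbhs|].
  by move=> _ p Ap Bp; have : (A `&` B) p by []; rewrite AB0.
(* disjoint neighbourhoods of the points c_j and c_k, for j and k adjacent *)
pose AB j k := projT1 (cid (sep j k)).
have ABP j k := projT2 (cid (sep j k)); rewrite -/(AB _ _) in ABP.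
have /choice[W WP] i : exists U, [/\ cell (R := R) U, U (coord c i), U `<=` O i &
    forall p k, U p -> (AB i k).1 p /\ (AB k i).2 p].
  have : nbhs (coord c i) [set p | O i p /\ forall k, (AB i k).1 p /\ (AB k i).2 p].
    apply: filterI; first exact: open_nbhs_nbhs.
    apply: filter_forall => k.
    by apply: filterI; [have [] := ABP i k|have [] := ABP k i].
  rewrite nbhsE => -[U [oU Uc] UO]; have [V [cV Vc VU]] := baseX oU Uc.
  exists V; split=> // [p /VU/UO[]//|p k /VU/UO[_]]; exact.
exists W; split.
- split=> [i|j k p jk Wj Wk]; first by have [] := WP i.
  have [_ _ _ /(_ p k Wj)[Aj _]] := WP j; have [_ _ _ /(_ p j Wk)[_ Bk]] := WP k.
  by have [_ _ /(_ jk p Aj)] := ABP j k.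
- by move=> i; have [] := WP i.
- by move=> i; have [] := WP i.
Qed.

End Boxes.

(** * Deforming paths into the classical configuration space *)

Section LocallyConstant.
Context {T : topologicalType}.

Lemma connected_locally_constant (P : T -> Prop) : connected [set: T] ->
  (forall x, \forall y \near x, P y <-> P x) -> forall x y, P x -> P y.
Proof.
move=> cT lP x y Px; suff -> : P = setT by [].
apply: cT; first by exists x.
- exists (P : set T); last by rewrite setTI.
  rewrite openE => z Pz; rewrite /interior /=.
  by apply: filterS (lP z) => z' /iffRL; apply.
- exists (P : set T); last by rewrite setTI.
  rewrite -[X in closed X]setCK; apply: open_closedC.
  rewrite openE => z Pz; rewrite /interior /=.
  by apply: filterS (lP z) => z' /iffLR PP /PP.
Qed.

End LocallyConstant.

Section Subpaths.
Context {R : realType} {Y : topologicalType}.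
Local Notation I := (unit_interval R).
Implicit Types (f : I -> Y) (s t u : R).

(** The affine path from [s] to [t], clamped to the unit interval; [s] may exceed
    [t]. *)
Definition seg s t (v : I) : I := clamp ((1 - ui_val v) * s + ui_val v * t).

Lemma seg0 s t : seg s t zero = clamp s.
Proof. by rewrite /seg ui_val0 subr0 mul1r mul0r addr0. Qed.

Lemma seg1 s t : seg s t one = clamp t.
Proof. by rewrite /seg ui_val1 subrr mul1r mul0r add0r. Qed.

Let affine_continuous (T : topologicalType) (a : T -> R) s t :
  continuous a -> continuous (fun v => (1 - a v) * s + a v * t).
Proof.
move=> ca v; apply: cvgD; apply: cvgM; try exact: cvg_cst; last exact: ca.
by apply: cvgB; [exact: cvg_cst|exact: ca].
Qed.

Lemma seg_continuous s t : continuous (seg s t).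
Proof.
exact: (comp_cts (@affine_continuous _ _ s t (@ui_val_continuous R)) (@clamp_continuous R)).
Qed.

Lemma subpath_cat f s t u : continuous f ->
  homotopic (path_cat (f \o seg s t) (f \o seg t u)) (f \o seg s u).
Proof.
move=> cf; rewrite -path_cat_comp; apply: homotopic_reparam => //.
- by apply: path_cat_continuous; [exact: seg_continuous..|rewrite seg0 seg1].
- exact: seg_continuous.
- by rewrite path_cat0 !seg0.
- by rewrite path_cat1 !seg1.
Qed.

End Subpaths.

Section Deformation.
Context {R : realType} {X : topologicalType} {n : nat} (Gam : simple_graph n).
Local Notation I := (unit_interval R).
Local Notation K := (complete_graph n).
Implicit Types (f g : I -> conf X Gam) (W : 'I_n -> set X).

(** [f] is homotopic, relative to its ends, to a path of pairwise distinct
    points. *)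
Definition deformable f : Prop :=
  exists2 b : I -> conf X K, continuous b & homotopic (conf_incl Gam \o b) f.

Lemma conf_incl_inj : injective (@conf_incl X n Gam).
Proof. by move=> y z yz; apply: conf_eqP => i; exact: (congr1 (fun c => coord c i) yz). Qed.

Lemma deformable_homotopic f g : homotopic f g -> deformable f -> deformable g.
Proof. by move=> fg [b cb bf]; exists b => //; exact: homotopic_trans bf fg. Qed.

Lemma deformable_cat f g : f one = g zero ->
  deformable f -> deformable g -> deformable (path_cat f g).
Proof.
move=> fg [a ca af] [b cb bg].
have e : (conf_incl Gam \o a) one = (conf_incl Gam \o b) zero.
  by have [_ ->] := homotopic_end af; have [-> _] := homotopic_end bg.
exists (path_cat a b).
  by apply: path_cat_continuous => //; exact: conf_incl_inj e.
by rewrite path_cat_comp; exact: homotopic_cat.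
Qed.

Lemma box_deformable W f (y z : conf X K) : box (R := R) Gam W -> continuous f ->
  (forall s, in_box W (f s)) -> f zero = conf_incl Gam y -> f one = conf_incl Gam z ->
  deformable f.
Proof.
move=> bW cf Wf f0 f1.
have Wy : in_box W y by move=> i; have := Wf zero i; rewrite f0.
have Wz : in_box W z by move=> i; have := Wf one i; rewrite f1.
have [b [cb b0 b1 Wb]] := box_connected (box_cell bW) Wy Wz.
exists b => //; apply: (box_homotopic bW) => //.
- by apply: comp_cts => //; exact: conf_incl_continuous.
- by rewrite /= b0 f0.
- by rewrite /= b1 f1.
Qed.

Context (hausX : hausdorff_space X).
Context (baseX : cell_basis R X).

(** Every path of [F(X, Gam)] with both ends in [F(X, n)] is deformable.  The
    initial part of the path up to the time [t] ends at an arbitrary point of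
    [F(X, Gam)], so it is completed by a short path to [F(X, n)], inside a box;
    the property [Q t] that all these completions are deformable is locally
    constant in [t]. *)
Theorem path_deformable f (y z : conf X K) : continuous f ->
  f zero = conf_incl Gam y -> f one = conf_incl Gam z -> deformable f.
Proof.
move=> cf f0 f1.
have cseg s t : continuous (f \o seg s t).
  by apply: comp_cts => //; exact: seg_continuous.
pose Q t := forall W (g : I -> conf X Gam) w, box (R := R) Gam W -> continuous g ->
  (forall s, in_box W (g s)) -> g zero = f (clamp t) -> g one = conf_incl Gam w ->
  deformable (path_cat (f \o seg 0 t) g).
(* Let f_t be the part of f up to t, and g' a path from f(t) to F(X, n) inside
   both boxes.  Then f_t.g is homotopic to (f_s.(f_st.g')).(g'^-1.g), where f_st is
   the part of f between s and t: the first factor is deformable by Q s, as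
   f_st.g' is inside W0, and the second one since it is inside W. *)
have step W0 s t : box (R := R) Gam W0 -> (forall u, in_box W0 (f (seg s t u))) -> Q s -> Q t.
  move=> bW0 W0f Qs W g w bW cg Wg g0 g1.
  have [W1 [bW1 W1c W1O]] := @box_base R X n hausX baseX Gam (f (clamp t))
    (fun i => W i `&` W0 i)
    (fun i => openI (cell_open (box_cell bW i)) (cell_open (box_cell bW0 i)))
    (fun i => conj (eq_ind _ (fun c => W i (coord c i)) (Wg zero i) _ g0)
                   (eq_ind _ (fun v => W0 i (coord (f v) i)) (W0f one i) _ (seg1 s t))).
  have [y1 [g' [cg' g'0 g'1 W1g']]] := box_approx bW1 W1c.
  have Wg' v : in_box W (g' v) by move=> i; have [] := W1O i _ (W1g' v i).
  have W0g' v : in_box W0 (g' v) by move=> i; have [] := W1O i _ (W1g' v i).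
  have catW W' (a b : I -> conf X Gam) : (forall v, in_box W' (a v)) ->
      (forall v, in_box W' (b v)) -> forall v, in_box W' (path_cat a b v).
    by move=> Wa Wb v; rewrite /path_cat; case: ifP.
  have e1 : (f \o seg s t) one = g' zero by rewrite /= seg1 g'0.
  have e2 : path_rev g' one = g zero by rewrite path_rev1 g'0 g0.
  have e3 : (f \o seg 0 s) one = (f \o seg s t) zero by rewrite /= seg0 seg1.
  have e4 : g' one = path_rev g' zero by rewrite path_rev0.
  have e5 : (f \o seg 0 t) one = g' zero by rewrite /= seg1 g'0.
  have crev : continuous (path_rev g') by exact: path_rev_continuous.
  have crg : continuous (path_cat (path_rev g') g) by exact: path_cat_continuous.
  have D1 : deformable (path_cat (f \o seg 0 s) (path_cat (f \o seg s t) g')).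
    apply: (Qs W0 _ y1) => //.
    + exact: path_cat_continuous.
    + exact: catW.
    + by rewrite path_cat0 /= seg0.
    + by rewrite path_cat1.
  have D2 : deformable (path_cat (path_rev g') g).
    apply: (@box_deformable W _ y1 w) => //.
    + by apply: catW => // v; exact: Wg'.
    + by rewrite path_cat0 path_rev0.
    + by rewrite path_cat1.
  have /deformable_cat/(_ D1 D2) D : path_cat (f \o seg 0 s) (path_cat (f \o seg s t) g') one =
      path_cat (path_rev g') g zero.
    by rewrite !path_cat1 path_cat0 path_rev0.
  apply: deformable_homotopic D.
  apply: (@homotopic_trans _ _ _
    (path_cat (path_cat (f \o seg 0 t) g') (path_cat (path_rev g') g))).
    apply: homotopic_cat.
    - by rewrite !path_cat1 path_cat0 path_rev0.
    - apply: homotopic_trans (homotopic_sym (homotopic_catA _ _ _ _ _)) _ => //.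
      apply: homotopic_cat; [by rewrite path_cat1|exact: subpath_cat|exact: homotopic_refl].
    - exact: homotopic_refl.
  apply: homotopic_trans (homotopic_catA _ _ _ _ _) _ => //.
    by rewrite path_cat0.
  apply: homotopic_cat; [|exact: homotopic_refl|].
    by rewrite path_cat0.
  apply: (box_homotopic bW) => //.
  - by apply: path_cat_continuous => //; rewrite path_cat0.
  - by apply: (catW) => //; apply: (catW) => // v; exact: Wg'.
  - by rewrite path_cat0 g0.
  - by rewrite !path_cat1.
have Qloc t : \forall s \near t, Q s <-> Q t.
  have [W [bW Wc _]] := @box_base R X n hausX baseX Gam (f (clamp t)) (fun=> setT)
    (fun=> openT) (fun=> Logic.I).
  have : nbhs t [set s | forall i, W i (coord (f (clamp s)) i)].
    apply: (@filter_forall R 'I_n (fun i s => W i (coord (f (clamp s)) i)) _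
      (@nbhs_filter R t)) => i.
    have cfi : continuous (fun s => coord (f (clamp s)) i).
      apply: (@comp_cts _ _ _ (@clamp R) (fun v => coord (f v) i)); first exact: clamp_continuous.
      by apply: (@comp_cts _ _ _ f (fun c => coord c i)) => //; exact: coord_continuous.
    by apply: cfi; apply: open_nbhs_nbhs; split=> //; exact: cell_open (box_cell bW i).
  move=> /nbhs_ballP[e e0 We].
  have Wseg s s' : ball t e s -> ball t e s' -> forall u, in_box W (f (seg s s' u)).
    rewrite -ball_normE /= !ltr_norml => /andP[s1 s2] /andP[s3 s4] u; apply: We.
    rewrite -ball_normE /= ltr_norml; have /andP[u0 u1] := ui_valP u.
    by apply/andP; split; have [uh|uh] := lerP (ui_val u) 2^-1; nra.
  apply/nbhs_ballP; exists e => // s ts.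
  have tt : ball t e t by exact: ballxx.
  by split; apply: (step W) => //; exact: Wseg.
have Q0 : Q 0.
  move=> W g w bW cg Wg g0 g1.
  have -> : f \o seg 0 0 = cst (g zero).
    by apply/funext => v; rewrite g0 /= /seg !mulr0 addr0.
  apply: deformable_homotopic (homotopic_sym (homotopic_cstl cg)) _.
  by apply: (@box_deformable W _ y w) => //; rewrite g0 clamp_le0.
have Q1 : Q 1.
  have cR : connected [set: R] by apply/connected_intervalP => a b.
  exact: (@connected_locally_constant R Q cR Qloc 0 1 Q0).
have [W [bW Wc _]] := @box_base R X n hausX baseX Gam (f one) (fun=> setT)
    (fun=> openT) (fun=> Logic.I).
have fE : f \o seg 0 1 = f.
  by apply/funext => v; rewrite /= /seg mulr0 add0r mulr1 clampK.
have := Q1 W (cst (f one)) z bW; rewrite fE => /(_ (@cst_cts _ _ _) (fun=> Wc)).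
rewrite clamp_ge1// => /(_ erefl f1).
by apply: deformable_homotopic; exact: homotopic_cstr.
Qed.

End Deformation.

(** * Path connectedness *)

Section PathConnectedness.
Context {R : realType} {X : topologicalType}.
Local Notation I := (unit_interval R).
Context (X_connected : connected [set: X]).
Context (baseX : cell_basis R X).

Lemma cells_path_connected (p q : X) :
  exists f : I -> X, [/\ continuous f, f zero = p & f one = q].
Proof.
pose P q := exists f : I -> X, [/\ continuous f, f zero = p & f one = q].
have Pp : P p by exists (cst p); split=> //; exact: cst_cts.
apply: (@connected_locally_constant X P X_connected _ p q Pp) => {}q.
have [U [cU Uq _]] := baseX openT (Logic.I : setT q).
have Pstep y z : U y -> U z -> P y -> P z.
  move=> Uy Uz [f [cf f0 f1]].
  have [g [cg g0 g1 _]] := cell_avoid (F := [::]) cU Uy Uz isT isT.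
  exists (path_cat f g); rewrite path_cat0 path_cat1; split=> //.
  by apply: path_cat_continuous; rewrite ?f1.
have : nbhs q U by apply: open_nbhs_nbhs; split=> //; exact: cell_open cU.
by apply: filterS => y Uy; split; exact: Pstep.
Qed.

End PathConnectedness.

Section ConfigurationPaths.
Context {R : realType} {X : topologicalType} {n : nat}.
Local Notation I := (unit_interval R).
Local Notation K := (complete_graph n).
Context (hausX : hausdorff_space X).
Context (X_connected : connected [set: X]).
Context (baseX : cell_basis R X).

Definition empty_graph : simple_graph n :=
  @SimpleGraph n (fun _ _ => false) (fun _ _ => erefl) (fun _ => erefl).

(** The space [F(X, empty_graph)] is the whole power of [X], hence it is path
    connected; its paths with ends in [F(X, n)] deform into [F(X, n)]. *)
Lemma complete_conf_path_connected (y z : conf X K) :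
  exists b : I -> conf X K, [/\ continuous b, b zero = y & b one = z].
Proof.
have /choice[f fP] i := cells_path_connected X_connected baseX (coord y i) (coord z i).
have fne s j k : empty_graph j k -> f j s <> f k s by [].
pose a s : conf X empty_graph := mk_conf (@fne s).
have [|||b cb ba] := @path_deformable R X n empty_graph hausX baseX a y z.
- by apply: conf_continuous => i; have [] := fP i.
- by apply: conf_eqP => i; have [] := fP i.
- by apply: conf_eqP => i; have [] := fP i.
have [b0 b1] := homotopic_end ba.
exists b; split=> //; apply: (@conf_incl_inj _ _ empty_graph).
- by rewrite [LHS]b0; apply: conf_eqP => i; have [] := fP i.
- by rewrite [LHS]b1; apply: conf_eqP => i; have [] := fP i.
Qed.

End ConfigurationPaths.

(** * The exact rows *)

Section ExtendedSequence.
Context {R : realType} {X : topologicalType} {n : nat} {Gam : simple_graph n}.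
Context {G : {group 'S_n}} (sG : G \subset Aut Gam) {x : conf X Gam}.
Context (injx : injective (coord x)).
Local Notation ext_path := (ext_path R sG x).
Implicit Types a b : ext_path.

Lemma ep_loop a : a one = x ->
  exists l : {path unit_interval R from x to x}, l = a :> (unit_interval R -> _).
Proof. by move=> a1; exists (mk_path (@ep_continuous _ _ _ _ _ _ _ a) (ep_start a) a1). Qed.

Lemma ep_perm_eq1 a : (ep_perm a = 1%g) <-> (a one = x).
Proof.
split=> [a1|a1]; first by rewrite ep_permP a1 conf_act1.
by apply: ep_perm_eq; rewrite // a1 conf_act1.
Qed.

Lemma ep_of_loop_cat (l l' : {path unit_interval R from x to x}) :
  ep_cat (ep_of_loop sG l) (ep_of_loop sG l') = path_cat l l' :> (_ -> _).
Proof.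
rewrite /=; congr (path_cat _ _); apply/funext => s /=.
have -> : ep_perm (ep_of_loop sG l) = 1%g by apply/ep_perm_eq1; rewrite /= path_one.
by rewrite conf_act1.
Qed.

Lemma pi1_pi1E_morph : {morph pi1_pi1E R sG injx : u v / (u * v)%g}.
Proof.
move=> u v; rewrite -(pi1_classK u) -(pi1_classK v).
rewrite -[(_ * _)%g in LHS]/(pi1_mul _ _) -[(_ * _)%g in RHS]/(pi1E_mul _ _).
rewrite pi1_mulE !pi1_pi1EE pi1E_mulE; apply/pi1E_classP.
by rewrite ep_of_loop_cat; apply: homotopic_refl; exact: cts_fun.
Qed.

Context (orbit_reached : forall s : [subg G], exists a, a one = conf_act sG s x).

Lemma pi1E_short_exact : short_exact (pi1_pi1E R sG injx) (pi1E_perm R sG injx).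
Proof.
split.
- exact: pi1_pi1E_morph.
- move=> u v; rewrite -(pi1E_classK u) -(pi1E_classK v).
  by rewrite -[(_ * _)%g in LHS]/(pi1E_mul _ _) pi1E_mulE !pi1E_permE// ep_perm_cat.
- move=> u v; rewrite -(pi1_classK u) -(pi1_classK v) !pi1_pi1EE.
  by move=> /pi1E_classP uv; apply/pi1_classP.
- apply/seteqP; split=> [_ [u _ <-]|u] /=.
    by rewrite -(pi1_classK u) pi1_pi1EE pi1E_permE//; apply/ep_perm_eq1; rewrite /= path_one.
  rewrite -(pi1E_classK u) pi1E_permE// => /ep_perm_eq1/ep_loop[l la].
  exists (pi1_class l) => //; rewrite pi1_pi1EE; apply/pi1E_classP.
  by rewrite /= la; apply: homotopic_refl; exact: ep_continuous.
- apply/seteqP; split=> // s _; have [a a1] := orbit_reached s.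
  by exists (pi1E_class injx a) => //; rewrite pi1E_permE//; exact: ep_perm_eq.
Qed.

End ExtendedSequence.

Section BraidSequence.
Context {R : realType} {X : topologicalType} {n : nat} {Gam : simple_graph n}.
Context {x : conf X Gam} (injx : injective (coord x)).
Local Notation sA := (Aut_refl Gam).
Context (orbit_reached :
  forall s : [subg Aut Gam], exists a : ext_path R sA x, a one = conf_act sA s x).

Lemma braid_mulgE (a b : ext_path R sA x) :
  (braid_class injx (braid_of a) * braid_class injx (braid_of b))%g =
  braid_class injx (braid_of (ep_cat a b)).
Proof. exact: braid_mulE. Qed.

Lemma braid_short_exact :
  short_exact (val : pure_braid_group R injx -> braid_group R injx) (braid_perm R injx).
Proof.
split.
- by [].
- move=> u v; rewrite -(braid_pathK u) -(braid_pathK v) braid_mulgE !braid_permE.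
  exact: ep_perm_cat.
- exact: val_inj.
- apply/seteqP; split=> [_ [[w wP] _ <-]|u] /=.
    move: wP; rewrite -(braid_pathK w) => /pure_braidP w1.
    by rewrite braid_permE; apply/(ep_perm_eq1 injx).
  rewrite -(braid_pathK u) braid_permE => /(ep_perm_eq1 injx)/(pure_braidP injx) u1.
  by exists (SigSub u1).
- apply/seteqP; split=> // s _; have [a a1] := orbit_reached s.
  by exists (braid_class injx (braid_of a)) => //; rewrite braid_permE; exact: ep_perm_eq.
Qed.

End BraidSequence.

(** * The vertical maps *)

Section InclusionMaps.
Context {R : realType} {X : topologicalType} {n : nat} (Gam : simple_graph n).
Context (x : conf X (complete_graph n)).
Local Notation I := (unit_interval R).
Local Notation K := (complete_graph n).
Local Notation sK := (Aut_complete Gam).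
Local Notation sA := (Aut_refl Gam).
Local Notation injK := (coord_complete_inj x).
Local Notation injG := (coord_incl_inj Gam x).

Lemma ep_perm_incl (a : ext_path R sK x) : ep_perm (ep_incl sA a) = ep_perm a.
Proof. by apply: (ep_perm_eq injG); rewrite /= ep_permP (conf_incl_act sK sA). Qed.

Lemma ep_incl_cat (a b : ext_path R sK x) :
  ep_incl sA (ep_cat a b) = ep_cat (ep_incl sA a) (ep_incl sA b) :> (I -> _).
Proof.
rewrite /= path_cat_comp ep_perm_incl; congr (path_cat _ _).
by apply/funext => s /=; rewrite (conf_incl_act sK sA).
Qed.

Lemma pi1_map_morph : {morph pi1_map R (conf_incl Gam) x : u v / (u * v)%g}.
Proof.
move=> u v; rewrite -(pi1_classK u) -(pi1_classK v).
rewrite -[(_ * _)%g in LHS]/(pi1_mul _ _) -[(_ * _)%g in RHS]/(pi1_mul _ _).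
rewrite pi1_mulE !pi1_mapE pi1_mulE; apply/pi1_classP.
have c : continuous (conf_incl Gam \o path_cat (pi1_repr u) (pi1_repr v)).
  apply: comp_cts; last exact: conf_incl_continuous.
  exact: (@cts_fun _ _ (loop_cat (pi1_repr u) (pi1_repr v))).
by have := homotopic_refl c; rewrite {2}path_cat_comp.
Qed.

Lemma pi1E_incl_morph : {morph pi1E_incl R Gam sK sA injK injG : u v / (u * v)%g}.
Proof.
move=> u v; rewrite -(pi1E_classK u) -(pi1E_classK v).
rewrite -[(_ * _)%g in LHS]/(pi1E_mul _ _) -[(_ * _)%g in RHS]/(pi1E_mul _ _).
rewrite pi1E_mulE// !pi1E_inclE pi1E_mulE//; apply/pi1E_classP.
by rewrite ep_incl_cat; apply: homotopic_refl; exact: ep_continuous.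
Qed.

Lemma braid_incl_morph : {morph braid_incl R Gam x : u v / (u * v)%g}.
Proof.
move=> u v; rewrite -(pi1E_classK u) -(pi1E_classK v).
rewrite -[(_ * _)%g in LHS]/(pi1E_mul _ _) pi1E_mulE// !braid_inclE braid_mulgE.
apply/braid_classP; rewrite ep_incl_cat; apply: homotopic_refl; exact: ep_continuous.
Qed.

Lemma pi1E_incl_pi1 :
  pi1E_incl R Gam sK sA injK injG \o pi1_pi1E R sK injK =
  pi1_pi1E R sA injG \o pi1_map R (conf_incl Gam) x.
Proof.
apply/funext => u /=; rewrite -(pi1_classK u) pi1_pi1EE pi1E_inclE pi1_mapE pi1_pi1EE.
by apply/pi1E_classP; apply: homotopic_refl; exact: ep_continuous.
Qed.

Lemma braid_incl_pi1 :
  braid_incl R Gam x \o pi1_pi1E R sK injK =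
  (val : pure_braid_group R injG -> braid_group R injG) \o pure_braid_incl R Gam x.
Proof.
apply/funext => u /=; rewrite -(pi1_classK u) pi1_pi1EE braid_inclE [RHS]pure_braid_inclE.
by apply/braid_classP; apply: homotopic_refl; exact: ep_continuous.
Qed.

Lemma pi1E_perm_incl : id \o pi1E_perm R sK injK =
  pi1E_perm R sA injG \o pi1E_incl R Gam sK sA injK injG.
Proof.
apply/funext => u /=; rewrite -(pi1E_classK u) pi1E_inclE !pi1E_permE//.
exact/esym/ep_perm_incl.
Qed.

Lemma braid_perm_incl : id \o pi1E_perm R sK injK =
  braid_perm R injG \o braid_incl R Gam x.
Proof.
apply/funext => u /=; rewrite -(pi1E_classK u) braid_inclE pi1E_permE// braid_permE.
exact/esym/ep_perm_incl.
Qed.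

Lemma pure_braid_incl_morph : {morph pure_braid_incl R Gam x : u v / (u * v)%g}.
Proof.
have E w : val (pure_braid_incl R Gam x w) = braid_incl R Gam x (pi1_pi1E R sK injK w).
  exact: (congr1 (fun f => f w) (esym braid_incl_pi1)).
move=> u v; apply: val_inj; rewrite E pi1_pi1E_morph braid_incl_morph -!E.
by [].
Qed.

Context (deform : forall (f : I -> conf X Gam) (y z : conf X K), continuous f ->
  f zero = conf_incl Gam y -> f one = conf_incl Gam z -> deformable f).

(** As the deformation fixes the ends, the deformed path has the ends [y] and [z]
    in [F(X, n)] itself. *)
Lemma deform_ends (f : I -> conf X Gam) (y z : conf X K) : continuous f ->
  f zero = conf_incl Gam y -> f one = conf_incl Gam z ->
  exists b : I -> conf X K, [/\ continuous b, b zero = y, b one = z &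
    homotopic (conf_incl Gam \o b) f].
Proof.
move=> cf f0 f1; have [b cb bf] := deform cf f0 f1; have [b0 b1] := homotopic_end bf.
exists b; split=> //; apply: (@conf_incl_inj _ _ Gam).
  by rewrite -f0 -b0.
by rewrite -f1 -b1.
Qed.

Lemma deform_loop (a : ext_path R sA (conf_incl Gam x)) : a one = conf_incl Gam x ->
  exists l : {path I from x to x}, homotopic (conf_incl Gam \o l) a.
Proof.
move=> a1; have [b [cb b0 b1 ba]] := deform_ends (@ep_continuous _ _ _ _ _ _ _ a) (ep_start a) a1.
by exists (mk_path cb b0 b1).
Qed.

Lemma deform_ext_path (a : ext_path R sA (conf_incl Gam x)) :
  exists b : ext_path R sK x, homotopic (ep_incl sA b) a.
Proof.
have a1 : a one = conf_incl Gam (conf_act sK (ep_perm a) x).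
  by rewrite (conf_incl_act sK sA) -ep_permP.
have [b [cb b0 b1 ba]] := deform_ends (@ep_continuous _ _ _ _ _ _ _ a) (ep_start a) a1.
by exists (ExtPath cb b0 (ex_intro _ _ b1)).
Qed.

Lemma pi1_map_surj : range (pi1_map R (conf_incl Gam) x) = setT.
Proof.
apply/seteqP; split=> // u _; rewrite -(pi1_classK u).
have [l la] := deform_loop (a := ep_of_loop sA (pi1_repr u)) path_one.
by exists (pi1_class l) => //; rewrite pi1_mapE; apply/pi1_classP.
Qed.

Lemma pi1E_incl_surj : range (pi1E_incl R Gam sK sA injK injG) = setT.
Proof.
apply/seteqP; split=> // u _; rewrite -(pi1E_classK u).
have [b ba] := deform_ext_path (pi1E_repr u).
by exists (pi1E_class injK b) => //; rewrite pi1E_inclE; apply/pi1E_classP.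
Qed.

Lemma braid_incl_surj : range (braid_incl R Gam x) = setT.
Proof.
apply/seteqP; split=> // u _; rewrite -(braid_pathK u).
have [b ba] := deform_ext_path (braid_path u).
by exists (pi1E_class injK b) => //; rewrite braid_inclE; apply/braid_classP.
Qed.

Lemma pure_braid_incl_surj : range (pure_braid_incl R Gam x) = setT.
Proof.
apply/seteqP; split=> // -[w wP] _.
have w1 : braid_path w one = conf_incl Gam x.
  by apply/(pure_braidP injG); rewrite braid_pathK.
have [l la] := deform_loop w1.
exists (pi1_class l) => //; apply: val_inj; rewrite [LHS]pure_braid_inclE [RHS]/= -(braid_pathK w).
exact/braid_classP.
Qed.

End InclusionMaps.

(** * The morphism of exact sequences *)

Theorem proposition2p2 (R : realType) (X : topologicalType) (m : nat)
    (m_gt1 : (1 < m)%N) (X_manifold : topological_manifold R m X)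
    (X_connected : connected [set: X])
    (n : nat) (Gam : simple_graph n) (x : conf X (complete_graph n)) :
  ses_epimorphism
    (pi1_pi1E R (Aut_complete Gam) (coord_complete_inj x))
    (pi1E_perm R (Aut_complete Gam) (coord_complete_inj x))
    (pi1_pi1E R (Aut_refl Gam) (coord_incl_inj Gam x))
    (pi1E_perm R (Aut_refl Gam) (coord_incl_inj Gam x))
    (pi1_map R (conf_incl Gam) x)
    (pi1E_incl R Gam (Aut_complete Gam) (Aut_refl Gam)
       (coord_complete_inj x) (coord_incl_inj Gam x))
    id
  /\
  ses_epimorphism
    (pi1_pi1E R (Aut_complete Gam) (coord_complete_inj x))
    (pi1E_perm R (Aut_complete Gam) (coord_complete_inj x))
    (val : pure_braid_group R (coord_incl_inj Gam x) ->
           braid_group R (coord_incl_inj Gam x))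
    (braid_perm R (coord_incl_inj Gam x))
    (pure_braid_incl R Gam x)
    (braid_incl R Gam x)
    id.
Proof.
have [hausX _ _] := X_manifold.
have baseX := manifold_cell_basis m_gt1 X_manifold.
have deform := @path_deformable R X n Gam hausX baseX.
have orbitK (s : [subg Aut Gam]) : exists a : ext_path R (Aut_complete Gam) x,
    a one = conf_act (Aut_complete Gam) s x.
  have [b [cb b0 b1]] := complete_conf_path_connected hausX X_connected baseX x
    (conf_act (Aut_complete Gam) s x).
  by exists (ExtPath cb b0 (ex_intro _ s b1)).
have orbitG (s : [subg Aut Gam]) : exists a : ext_path R (Aut_refl Gam) (conf_incl Gam x),
    a one = conf_act (Aut_refl Gam) s (conf_incl Gam x).
  have [a a1] := orbitK s; exists (ep_incl (Aut_refl Gam) a).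
  by rewrite /= a1 (conf_incl_act (Aut_complete Gam) (Aut_refl Gam)).
have idT : range (id : [subg Aut Gam] -> [subg Aut Gam]) = setT.
  by apply/seteqP; split=> // s _; exists s.
split; split.
- by split; exact: pi1E_short_exact.
- by split; [exact: pi1_map_morph|exact: pi1E_incl_morph|].
- exact: pi1E_incl_pi1.
- exact: pi1E_perm_incl.
- by split; [exact: pi1_map_surj|exact: pi1E_incl_surj|].
- by split; [exact: pi1E_short_exact|exact: braid_short_exact].
- by split; [exact: pure_braid_incl_morph|exact: braid_incl_morph|].
- exact: braid_incl_pi1.
- exact: braid_perm_incl.
- by split; [exact: pure_braid_incl_surj|exact: braid_incl_surj|].
Qed.
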